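(* Let $K$ be an equivelar (polyhedral) map on a surface, and let $M$ be the dual map of $K$. Then the edge graph $EG(K)$ of $K$ has a contractible Hamiltonian cycle if and only if the edge graph $EG(M)$ of $M$ has a proper tree.
   Context: A surface is a connected compact 2-manifold without boundary. A map on a surface $S$ is an embedding of a finite simple graph $G$ in $S$ such that the closures of the components of $S\setminus G$ (the facets or faces) are $p$-gonal 2-disks with $p\ge 3$; its edge graph $EG$ is $G$. The map is polyhedral if any two facets meet in either the empty set, a single vertex, or a single edge (here ''map'' means polyhedral map). A polyhedral map is $\{p,q\}$-equivelar ($p,q\ge 3$) if every facet is a $p$-gon and each vertex is incident with exactly $q$ facets; a map is equivelar if it is $\{p,q\}$-equivelar for some $p,q$. The dual map $M$ of $K$ is the map on the same surface whose vertices are the facets of $K$, two being joined by an edge iff the corresponding facets of $K$ share an edge; faces of $M$ correspond to vertices of $K$. A cycle in $EG(K)$ is contractible if it bounds a 2-disk in the surface. Let $K$ have $n$ vertices. A tree $T$ in $EG(M)$ with vertex set $\{v_1,\dots,v_k\}$ is a proper tree if: (1) $\sum_{i=1}^k \deg(v_i)=n+2(k-1)$, where $\deg$ is the degree in $EG(M)$; (2) whenever two vertices $u_1,u_2$ of $T$ lie on a face $F$ of $M$, a path joining $u_1$ and $u_2$ in the boundary $\partial F$ of $F$ is part of $T$; (3) every path in $T$ that lies in a face $F$ of $M$ has length at most $q-2$, where $q$ is the length of $\partial F$. *)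

(* Defs.v *)
From mathcomp Require Import all_boot.
Set Implicit Arguments.
Unset Strict Implicit.
Unset Printing Implicit Defensive.

(* A map is given by its facets: [K : F -> seq V] sends each facet to the      *)
(* cyclic sequence of the vertices on its boundary. The surface is the space   *)
(* obtained by gluing one p-gonal disk per facet along common edges.           *)
(* Orientability is not assumed, and cyclic sequences carry no orientation.    *)

(* [u] and [v] are joined by an edge of the closed polygon [s]. *)
Definition polygon_edge (T : eqType) (s : seq T) : rel T :=
  fun u v => [&& u \in s, v \in s & (next s u == v) || (next s v == u)].

Definition is_polygon (T : eqType) (s : seq T) : bool := uniq s && (2 < size s).

Definition edge_graph (V F : finType) (K : F -> seq V) : rel V :=
  fun u v => [exists f, polygon_edge (K f) u v].

(* Vertex links are cycles: the facets around [v] form a single cyclic         *)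
(* sequence in which consecutive facets share an edge incident with [v].       *)
Definition is_fan (V F : finType) (K : F -> seq V) (v : V) (c : seq F) : Prop :=
  [/\ c != [::], uniq c, forall f, (f \in c) = (v \in K f)
    & cycle (fun f g => [exists w, polygon_edge (K f) v w && polygon_edge (K g) v w]) c].

(* The polygons glue to a closed connected 2-manifold. *)
Record surface_map (V F : finType) (K : F -> seq V) : Prop := SurfaceMap {
  surface_nonempty : 0 < #|V|;
  surface_polygon : forall f, is_polygon (K f);
  surface_edge : forall u v, edge_graph K u v ->
    #|[set f | polygon_edge (K f) u v]| = 2;
  surface_link : forall v, exists c, is_fan K v c;
  surface_connected : forall u v, connect (edge_graph K) u v
}.

Definition common_vertices (V F : finType) (K : F -> seq V) (f g : F) : {set V} :=
  [set v | (v \in K f) && (v \in K g)].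

Definition polyhedral_map (V F : finType) (K : F -> seq V) : Prop :=
  surface_map K /\
  forall f g, f != g ->
    [\/ common_vertices K f g = set0,
        exists v, common_vertices K f g = [set v]
      | exists u v, [/\ common_vertices K f g = [set u; v],
                        polygon_edge (K f) u v & polygon_edge (K g) u v]].

Definition pq_equivelar (V F : finType) (K : F -> seq V) (p q : nat) : Prop :=
  [/\ 3 <= p, 3 <= q, forall f, size (K f) = p
    & forall v, #|[set f | v \in K f]| = q].

Definition equivelar (V F : finType) (K : F -> seq V) : Prop :=
  exists p q, pq_equivelar K p q.

Definition share_edge (V F : finType) (K : F -> seq V) (f g : F) : bool :=
  [exists u, exists v, polygon_edge (K f) u v && polygon_edge (K g) u v].

(* [M v] is the boundary of the face of the dual that corresponds to the       *)
(* vertex [v]; it is determined by [K] up to rotation and reversal.            *)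
Definition dual_map (V F : finType) (K : F -> seq V) (M : V -> seq F) : Prop :=
  (forall f g, edge_graph M f g = (f != g) && share_edge K f g) /\
  (forall v, uniq (M v) /\ forall f, (f \in M v) = (v \in K f)).

Definition is_cycle (T : eqType) (e : rel T) (c : seq T) : Prop :=
  [/\ uniq c, 2 < size c & cycle e c].

Definition hamiltonian_cycle (T : finType) (e : rel T) (c : seq T) : Prop :=
  is_cycle e c /\ forall x, x \in c.

(* Finite polygonal 2-complexes over a label type [T], as lists of polygons;   *)
(* vertices are labels and edges are determined by their end points.           *)

Definition complex_edge (T : eqType) (X : seq (seq T)) (u v : T) : bool :=
  has (fun s => polygon_edge s u v) X.

(* Insert [w] in the middle of the edge [uv] of [s], if [s] has that edge. *)
Definition insert_vertex (T : eqType) (u v w : T) (s : seq T) : seq T :=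
  flatten [seq if ((x == u) && (next s x == v)) || ((x == v) && (next s x == u))
               then [:: x; w] else [:: x] | x <- s].

(* Combinatorial (piecewise linear) homeomorphism in the sense of Seifert and  *)
(* Threlfall: the equivalence generated by the elementary subdivisions, which  *)
(* are placing a new vertex inside an edge and cutting a polygon in two by a   *)
(* diagonal.                                                                   *)
Inductive pl_homeo (T : eqType) : seq (seq T) -> seq (seq T) -> Prop :=
| pl_refl X : pl_homeo X X
| pl_sym X Y : pl_homeo X Y -> pl_homeo Y X
| pl_trans X Y Z : pl_homeo X Y -> pl_homeo Y Z -> pl_homeo X Z
| pl_perm X Y : perm_eq X Y -> pl_homeo X Y
| pl_rot n s X : pl_homeo (s :: X) (rot n s :: X)
| pl_rev s X : pl_homeo (s :: X) (rev s :: X)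
| pl_subdivide_edge u v w X of
    all (@is_polygon T) X & complex_edge X u v & w \notin flatten X :
    pl_homeo X [seq insert_vertex u v w s | s <- X]
| pl_cut_polygon u v s1 s2 X of
    all (@is_polygon T) ((u :: s1 ++ v :: s2) :: X) &
    s1 != [::] & s2 != [::] & ~~ complex_edge X u v :
    pl_homeo ((u :: s1 ++ v :: s2) :: X)
             ((u :: rcons s1 v) :: (v :: rcons s2 u) :: X).

Definition is_disk (T : eqType) (X : seq (seq T)) : Prop :=
  exists2 s, is_polygon s & pl_homeo X [:: s].

(* The subcomplex of [K] formed by the facets in [A]; vertices are relabelled  *)
(* injectively in [nat], so that subdivisions never run out of new vertices.   *)
Definition facet_complex (V F : finType) (K : F -> seq V) (A : {set F}) :
  seq (seq nat) := [seq [seq pickle v | v <- K f] | f <- enum A].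

(* A disk in the surface bounded by a cycle of the edge graph is a union of    *)
(* facets, and its boundary consists of the edges lying on exactly one of them.*)
Definition contractible (V F : finType) (K : F -> seq V) (c : seq V) : Prop :=
  exists A : {set F}, is_disk (facet_complex K A) /\
    forall u v, polygon_edge c u v = (#|[set f in A | polygon_edge (K f) u v]| == 1).

Definition deg (T : finType) (e : rel T) (x : T) : nat := #|[set y | e x y]|.

(* The pair of a vertex set [VT] and an edge relation [ET] is a tree that is a *)
(* (not necessarily induced) subgraph of [e].                                  *)
Record tree_in (T : finType) (e : rel T) (VT : {set T}) (ET : rel T) : Prop := TreeIn {
  tree_sym : symmetric ET;
  tree_edge : forall x y, ET x y -> [&& x \in VT, y \in VT & e x y];
  tree_nonempty : VT != set0;
  tree_connected : forall x y, x \in VT -> y \in VT -> connect ET x y;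
  tree_acyclic : forall c, ~ is_cycle ET c
}.

(* [x :: s] is a simple path, of length [size s], whose edges are edges of the *)
(* tree lying on the boundary polygon [b].                                     *)
Definition tree_path_on (T : eqType) (ET : rel T) (b : seq T) (x : T) (s : seq T) : bool :=
  uniq (x :: s) && path (fun y z => ET y z && polygon_edge b y z) x s.

(* The faces of [M] are indexed by the vertices of the map it is dual to, so   *)
(* [#|V|] is the number of vertices of that map.                               *)
Record proper_tree (V F : finType) (M : V -> seq F) (VT : {set F}) (ET : rel F) : Prop :=
  ProperTree {
  proper_tree_in : tree_in (edge_graph M) VT ET;
  proper_degree : \sum_(f in VT) deg (edge_graph M) f = #|V| + 2 * (#|VT| - 1);
  proper_face_path : forall v x y, x \in VT -> y \in VT -> x \in M v -> y \in M v ->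
    exists2 s, tree_path_on ET (M v) x s & last x s = y;
  proper_face_length : forall v x s, x \in VT -> x \in M v ->
    tree_path_on ET (M v) x s -> size s <= size (M v) - 2
}.

(* Main.v *)
Require Import Defs.
From mathcomp Require Import all_boot zify.

(* Elementary subdivisions preserve the Euler characteristic. So if a Hamiltonian *)
(* cycle bounds a disk with facet set A, all vertices of the disk lie on its      *)
(* boundary, and the Euler formula gives |A| - 1 interior edges and the degree    *)
(* condition. Around a vertex v the boundary of the disk is crossed only on the   *)
(* two edges of the cycle at v, hence the facets of A at v are consecutive in the *)
(* face M v; this gives the face conditions, and together with the cycle the      *)
(* connectedness of the dual graph on A, which by the edge count is then a tree.  *)
(* Conversely, grow the tree by one facet f at a time. By uniqueness of tree      *)
(* paths and the face path condition, f meets the facets already used in exactly  *)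
(* one edge, so it can be glued to the polygon that they have been merged into.   *)
(* The final polygon is the boundary of a disk, and by the degree condition it    *)
(* has |V| vertices.                                                              *)

Set Implicit Arguments.
Unset Strict Implicit.
Unset Printing Implicit Defensive.

(** * Polygons *)

(** Both directions rest on one count. Suppose the facets in [A] form a disk whose boundary visits
    all [|V|] vertices. There is then no inner vertex, so with [i] inner edges the Euler relation
    [|V| - (|V| + i) + |A| = 1] gives [i = |A| - 1]. Inner edges correspond to edges of the dual
    graph induced on [A], so this graph is a tree as soon as it is connected. The facet sizes count
    boundary edges once and inner edges twice, which is the degree condition. The relation comes
    from [pl_homeo_euler], the counts from [disk_counts] and [sum_adjacent_facets]; the face
    conditions and connectedness come from the local picture in [disk_facets_consecutive].

    Conversely, gluing [k] facets along the edges of a tree loses two sides per gluing, so the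
    degree condition leaves a polygon with exactly [|V|] sides. The point is that the polygon stays
    simple. If a new facet [f], attached to [a], met an old facet [h] in [w], the dual face of [w]
    would contain a tree path from [f] to [h]; in a tree it must start with the edge to [a], so [w]
    lies on [a] too ([attachment_vertex]). Polyhedrality then puts [w] on the edge common to [f] and
    [a]. This drives [merges_toU1], whence [tree_hamiltonian_disk]. *)

Section Arcs.
Variable T : eqType.
Implicit Types (x y u v w : T) (s t : seq T) (e : rel T).

(** With the steps of a path as a list, cutting and joining paths are plain list operations
    ([arcs_cat]), whereas [next] behaves badly under concatenation. [polygon_edgeE] translates
    between the two. *)
Fixpoint arcs x s : seq (T * T) :=
  if s is y :: s' then (x, y) :: arcs y s' else [::].

Definition cyclic_arcs s := if s is x :: s' then arcs x (rcons s' x) else [::].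

Definition swap (a : T * T) := (a.2, a.1).

(** Each edge appears in both orientations, so edges can be counted by ordered pairs. *)
Definition darts s := cyclic_arcs s ++ map swap (cyclic_arcs s).

Lemma arcs_cat x s1 y s2 :
  arcs x (s1 ++ y :: s2) = arcs x (rcons s1 y) ++ arcs y s2.
Proof. by elim: s1 x => [|z s1 IH] x //=; rewrite IH. Qed.

Lemma arcs_rcons x s y : arcs x (rcons s y) = rcons (arcs x s) (last x s, y).
Proof. by elim: s x => [|z s IH] x //=; rewrite IH. Qed.

Lemma unzip1_arcs x s : unzip1 (arcs x s) = belast x s.
Proof. by elim: s x => [|z s IH] x //=; rewrite IH. Qed.

Lemma unzip2_arcs x s : unzip2 (arcs x s) = s.
Proof. by elim: s x => [|z s IH] x //=; rewrite IH. Qed.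

Lemma path_arcs e x s : path e x s = all (fun a => e a.1 a.2) (arcs x s).
Proof. by elim: s x => [|z s IH] x //=; rewrite IH. Qed.

Lemma cycle_arcs e s : cycle e s = all (fun a => e a.1 a.2) (cyclic_arcs s).
Proof. by case: s => [|x s] //=; rewrite path_arcs. Qed.

Lemma unzip1_cyclic_arcs s : unzip1 (cyclic_arcs s) = s.
Proof. by case: s => [|x s] //=; rewrite unzip1_arcs belast_rcons. Qed.

Lemma size_cyclic_arcs s : size (cyclic_arcs s) = size s.
Proof. by rewrite -{2}[s]unzip1_cyclic_arcs size_map. Qed.

Lemma mem_cyclic_arcs s x y : uniq s ->
  ((x, y) \in cyclic_arcs s) = (x \in s) && (next s x == y).
Proof.
move=> Us.
have next_arc z : z \in s -> (z, next s z) \in cyclic_arcs s.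
  apply: (@next_cycle _ (fun a b => (a, b) \in cyclic_arcs s)).
  by rewrite cycle_arcs; apply/allP => -[].
apply/idP/andP=> [xy|[xs /eqP <-]]; last exact: next_arc.
have xs : x \in s by rewrite -[s]unzip1_cyclic_arcs; apply: (map_f fst xy).
(* The first components of the arcs are the vertices of [s], which are distinct, so two arcs that
   start at [x] coincide. *)
split=> //; move: xy (next_arc _ xs) Us; rewrite -{4}[s]unzip1_cyclic_arcs.
elim: (cyclic_arcs s) => [|[a b] l IH] //=.
rewrite !inE => /orP[/eqP[E1 E2]|xl] /orP[/eqP|xl'].
- by case=> _ ->; rewrite E2.
- by rewrite -E1 (map_f fst xl').
- by case=> <- _; rewrite (map_f fst xl).
- by case/andP=> _; apply: IH.
Qed.

Lemma polygon_edgeE s x y : uniq s ->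
  polygon_edge s x y = ((x, y) \in cyclic_arcs s) || ((y, x) \in cyclic_arcs s).
Proof.
move=> Us; rewrite !mem_cyclic_arcs // /polygon_edge.
case xs: (x \in s); case ys: (y \in s) => //=.
- by apply/esym/negbTE/negP; rewrite orbF => /eqP Ey; rewrite -Ey mem_next xs in ys.
- by apply/esym/negbTE/negP => /eqP Ex; rewrite -Ex mem_next ys in xs.
Qed.

Lemma mem_swap (l : seq (T * T)) x y : ((x, y) \in map swap l) = ((y, x) \in l).
Proof.
apply/mapP/idP => [[[a b] ab [-> ->]] //|yx].
by exists (y, x).
Qed.

Lemma mem_darts s x y : uniq s -> ((x, y) \in darts s) = polygon_edge s x y.
Proof. by move=> Us; rewrite mem_cat mem_swap polygon_edgeE. Qed.

Lemma size_darts s : size (darts s) = 2 * size s.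
Proof. by rewrite size_cat size_map size_cyclic_arcs mul2n addnn. Qed.

Lemma polygon_edge_sym s x y : polygon_edge s x y = polygon_edge s y x.
Proof. by rewrite /polygon_edge andbCA orbC. Qed.

Lemma polygon_edge_mem s x y : polygon_edge s x y -> (x \in s) && (y \in s).
Proof. by case/and3P=> -> ->. Qed.

Lemma polygon_edge_rot n s x y : uniq s ->
  polygon_edge (rot n s) x y = polygon_edge s x y.
Proof. by move=> Us; rewrite /polygon_edge !mem_rot !next_rot. Qed.

Lemma next_eq_prev s x y : uniq s -> (next s x == y) = (prev s y == x).
Proof.
by move=> Us; apply/eqP/eqP => <-; rewrite ?prev_next ?next_prev.
Qed.

Lemma polygon_edge_rev s x y : uniq s ->
  polygon_edge (rev s) x y = polygon_edge s x y.
Proof.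
move=> Us; rewrite /polygon_edge !mem_rev !next_rev // -!next_eq_prev //.
by rewrite [(_ == y) || _]orbC.
Qed.

Lemma is_polygon_rot n s : is_polygon (rot n s) = is_polygon s.
Proof. by rewrite /is_polygon rot_uniq size_rot. Qed.

Lemma is_polygon_rev s : is_polygon (rev s) = is_polygon s.
Proof. by rewrite /is_polygon rev_uniq size_rev. Qed.

(** This is where a polygon needs at least three vertices: a digon contains both arcs. *)
Lemma cyclic_arcs_asym s x y : is_polygon s ->
  (x, y) \in cyclic_arcs s -> (y, x) \notin cyclic_arcs s.
Proof.
case/andP=> Us ss; rewrite !mem_cyclic_arcs // => /andP[xs xy].
apply/negP => /andP[_]; case/rot_to: (xs) => i s' Es; move: xy.
rewrite -!(next_rot i Us) Es.
have := Us; rewrite -(rot_uniq i) Es; have := ss; rewrite -(size_rot i) Es.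
case: s' {Es} => [|a [|b s']] //= _; rewrite !inE !negb_or.
case/and3P=> /and3P[xa xb _] _ _; rewrite eqxx => /eqP <-.
by rewrite [a == x]eq_sym (negbTE xa) eqxx eq_sym (negbTE xb).
Qed.

Lemma uniq_darts s : is_polygon s -> uniq (darts s).
Proof.
move=> Ps; have /andP[Us _] := Ps.
have Ua : uniq (cyclic_arcs s).
  by apply: (@map_uniq _ _ fst); rewrite [map _ _]unzip1_cyclic_arcs.
rewrite cat_uniq Ua map_inj_uniq ?Ua ?andbT; last by move=> [a b] [c d] [-> ->].
apply/hasPn => -[x y]; rewrite mem_swap; exact: cyclic_arcs_asym.
Qed.

Lemma polygon_edge_neq s x y : is_polygon s -> polygon_edge s x y -> x != y.
Proof.
move=> Ps; have /andP[Us _] := Ps; rewrite polygon_edgeE //.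
apply: contraTneq => <-; rewrite orbb; apply/negP => h.
by have := cyclic_arcs_asym Ps h; rewrite h.
Qed.

Lemma polygon_edge_neighbours s x y : uniq s -> x \in s ->
  polygon_edge s x y = (y == next s x) || (y == prev s x).
Proof.
move=> Us xs; rewrite polygon_edgeE // !mem_cyclic_arcs // xs /=.
rewrite [next s x == y]eq_sym [next s y == x]next_eq_prev //.
rewrite [prev s x == y]eq_sym; case: eqVneq => //= _.
by apply: andb_idl => /eqP ->; rewrite mem_prev.
Qed.

(** Any edge can be made the closing edge of the list by a rotation, after a reversal if [b] says
    so. This is the form in which two polygons are glued. *)
Lemma polygon_edge_last s u v : is_polygon s -> polygon_edge s u v ->
  exists b n t, rot n (if b then rev s else s) = u :: rcons t v.
Proof.
move=> Ps; have /andP[Us ss] := Ps => /and3P[us vs uv].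
suff [b nb] : exists b, next (if b then rev s else s) v = u.
  set s' := (if b then _ else _) in nb *.
  have Us' : uniq s' by rewrite /s'; case: b {nb s'}; rewrite ?rev_uniq.
  have ss' : 2 < size s' by rewrite /s'; case: b {nb s' Us'}; rewrite ?size_rev.
  have us' : u \in s' by rewrite /s'; case: b {nb s' Us' ss'}; rewrite ?mem_rev.
  case/rot_to: us' => i t Es; exists b, i.
  case/lastP: t Es => [|t z] Es; first by have := ss'; rewrite -(size_rot i) Es.
  exists t; rewrite -/s' Es; congr (_ :: rcons _ _).
  have: (z, u) \in cyclic_arcs (rot i s').
    by rewrite Es /= arcs_rcons last_rcons mem_rcons mem_head.
  rewrite mem_cyclic_arcs ?rot_uniq // next_rot // => /andP[_].
  by rewrite next_eq_prev // => /eqP <-; rewrite -nb prev_next.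
case/orP: uv => /eqP E; last by exists false.
by exists true; rewrite next_rev // -E prev_next.
Qed.

Lemma darts_cut u v s1 s2 x y :
  ((x, y) \in darts (u :: rcons s1 v) ++ darts (v :: rcons s2 u)) =
  ((x, y) \in (u, v) :: (v, u) :: darts (u :: s1 ++ v :: s2)).
Proof.
rewrite /darts /cyclic_arcs !rcons_cat /= !arcs_cat !map_cat !arcs_rcons.
rewrite !(mem_cat, inE, mem_rcons, mem_swap) !last_rcons.
rewrite ![(y, x) == _]/eq_op /= ![(x, y) == _]/eq_op /=.
by do ![case: (_ == _) => //=]; do ![case: (_ \in _) => //=].
Qed.

Lemma is_polygon_cut u v s1 s2 : s1 != [::] -> s2 != [::] ->
  is_polygon (u :: s1 ++ v :: s2) ->
  is_polygon (u :: rcons s1 v) && is_polygon (v :: rcons s2 u).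
Proof.
rewrite -!size_eq0 -!lt0n => h1 h2; rewrite /is_polygon /= !rcons_uniq !size_rcons.
rewrite !ltnS !mem_rcons !inE !mem_cat !inE cat_uniq /= !negb_or h1 h2 !andbT.
case/andP=> /andP[/and3P[-> uv ->] /and3P[-> /andP[-> _] /andP[-> ->]]] _.
by rewrite uv eq_sym uv.
Qed.

Lemma polygon_edge_cut u v s1 s2 x y : s1 != [::] -> s2 != [::] ->
  is_polygon (u :: s1 ++ v :: s2) ->
  polygon_edge (u :: rcons s1 v) x y || polygon_edge (v :: rcons s2 u) x y =
  ((x, y) \in [:: (u, v); (v, u)]) || polygon_edge (u :: s1 ++ v :: s2) x y.
Proof.
move=> h1 h2 Ps; have /andP[/andP[U1 _] /andP[U2 _]] := is_polygon_cut h1 h2 Ps.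
have /andP[U _] := Ps.
by rewrite -!mem_darts // -mem_cat darts_cut !inE orbA.
Qed.

(** The closing arc [(v, u)] already joins the ends, and the darts of a polygon are distinct. *)
Lemma arcs_rcons_chord u v s : is_polygon (u :: rcons s v) ->
  ((u, v) \notin arcs u (rcons s v)) && ((v, u) \notin arcs u (rcons s v)).
Proof.
move=> Ps; have := uniq_darts Ps; rewrite cat_uniq => /and3P[+ _ _].
have E : cyclic_arcs (u :: rcons s v) = rcons (arcs u (rcons s v)) (v, u).
  by rewrite /= [arcs u (rcons (rcons s v) u)]arcs_rcons last_rcons.
rewrite E rcons_uniq => /andP[-> _]; rewrite andbT.
have := @cyclic_arcs_asym _ v u Ps; rewrite E !mem_rcons mem_head inE negb_or.
by case/(_ isT)/andP.
Qed.

Lemma polygon_edge_diagonal u v s1 s2 : s1 != [::] -> s2 != [::] ->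
  is_polygon (u :: s1 ++ v :: s2) -> ~~ polygon_edge (u :: s1 ++ v :: s2) u v.
Proof.
move=> h1 h2 Ps; have /andP[P1 P2] := is_polygon_cut h1 h2 Ps.
have /andP[U _] := Ps.
have /andP[n1 n2] := arcs_rcons_chord P1; have /andP[n3 n4] := arcs_rcons_chord P2.
rewrite polygon_edgeE // /cyclic_arcs rcons_cat /= arcs_cat !mem_cat.
by rewrite (negbTE n1) (negbTE n2) (negbTE n3) (negbTE n4).
Qed.

End Arcs.

(** * Invariance of the Euler characteristic *)

Section EulerCharacteristic.
Variable T : eqType.
Implicit Types (x y u v w : T) (s t : seq T) (X Y : seq (seq T)).

Lemma insert_vertexC u v w s : insert_vertex u v w s = insert_vertex v u w s.
Proof. by congr flatten; apply: eq_map => x; rewrite orbC. Qed.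

Lemma insert_vertex_id u v w s : uniq s -> ~~ polygon_edge s u v ->
  insert_vertex u v w s = s.
Proof.
move=> Us nuv; rewrite -[RHS]flatten_seq1; congr flatten.
apply/eq_in_map => x xs; rewrite ifN //; apply: contra nuv.
rewrite polygon_edgeE // !mem_cyclic_arcs //.
by case/orP=> /andP[/eqP <- ->]; rewrite xs ?orbT.
Qed.

(** A normal form: after rotations the old and the new polygon differ only by the [w] in second
    place. *)
Lemma insert_vertex_arc u v w s : is_polygon s -> (u, v) \in cyclic_arcs s ->
  exists n m t, rot n s = u :: v :: t /\ rot m (insert_vertex u v w s) = u :: w :: v :: t.
Proof.
move=> Ps uv; have /andP[Us ss] := Ps; have vu := cyclic_arcs_asym Ps uv.
have us : u \in s by move: uv; rewrite mem_cyclic_arcs // => /andP[].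
have insE x : x \in s -> (if ((x == u) && (next s x == v))
    || ((x == v) && (next s x == u)) then [:: x; w] else [:: x])
    = if x == u then [:: x; w] else [:: x].
  move=> xs; congr (if _ then _ else _).
  move: uv vu; rewrite !mem_cyclic_arcs // => /andP[_ uv].
  case: (eqVneq x u) => [->|xu]; first by rewrite uv.
  by case: (eqVneq x v) => [<-|//]; rewrite xs /= => /negbTE ->.
have {insE} -> : insert_vertex u v w s =
    flatten [seq if x == u then [:: x; w] else [:: x] | x <- s].
  by congr flatten; apply/eq_in_map => x /insE.
have hid r : u \notin r ->
    flatten [seq if x == u then [:: x; w] else [:: x] | x <- r] = r.
  move=> ur; rewrite -[RHS]flatten_seq1; congr flatten; apply/eq_in_map => x xr.
  by rewrite ifN //; apply: contraNneq ur => <-.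
have := Us; have := uv; have := ss; have := rot_size_cat; case/splitPr: us => s1 s2.
move=> rsc ss' uv' Us'.
have /andP[us1 us2] : (u \notin s1) && (u \notin s2).
  move: Us'; rewrite cat_uniq /= negb_or.
  by case/and3P=> _ /andP[-> _] /andP[-> _].
rewrite map_cat flatten_cat /= eqxx /= !hid //.
have Er := rsc _ s1 (u :: s2); exists (size s1), (size s1).
have: (u, v) \in cyclic_arcs (rot (size s1) (s1 ++ u :: s2)).
  move: uv'; rewrite !mem_cyclic_arcs ?rot_uniq // mem_rot next_rot //.
rewrite mem_cyclic_arcs ?rot_uniq // Er rot_size_cat /= => /andP[_].
case E: (s2 ++ s1) => [|v' t] /=.
  by move: ss' (congr1 size E); clear; rewrite !size_cat /=; lia.
by rewrite eqxx => /eqP ->; exists t.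
Qed.

Lemma polygon_edge_insert u v w s : is_polygon s -> w \notin s ->
  [/\ is_polygon (insert_vertex u v w s),
      forall x, (x \in insert_vertex u v w s) = (x \in s) || (polygon_edge s u v && (x == w))
    & forall x y, polygon_edge (insert_vertex u v w s) x y =
        polygon_edge s x y && ((x, y) \notin [:: (u, v); (v, u)]) ||
        polygon_edge s u v && ((x, y) \in [:: (u, w); (w, u); (w, v); (v, w)])].
Proof.
move=> Ps ws; have /andP[Us ss] := Ps.
have [uv|nuv] := boolP (polygon_edge s u v); last first.
  rewrite insert_vertex_id //; split=> //= [x|x y]; first by rewrite orbF.
  rewrite orbF; apply/esym/andb_idr => xy; rewrite !inE !xpair_eqE.
  apply: contra nuv; case/orP=> /andP[/eqP <- /eqP <-] //.
  by rewrite polygon_edge_sym.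
wlog: u v uv / (u, v) \in cyclic_arcs s => [hw|arc].
  move: (uv); rewrite polygon_edgeE // => /orP[] a; first exact: hw.
  have [||h1 h2 h3] := hw v u => //; first by rewrite polygon_edge_sym.
  rewrite insert_vertexC; split=> // x y; rewrite h3 !inE.
  by congr (_ && _ || _); first congr (~~ _); do ![case: (_ == _) => //=].
have [n [m [t [En Em]]]] := insert_vertex_arc w Ps arc.
have Pn : is_polygon (u :: v :: t) by rewrite -En is_polygon_rot.
have memn x : (x \in s) = (x \in u :: v :: t) by rewrite -En mem_rot.
have Pm : is_polygon (u :: w :: v :: t).
  move: Pn ws; rewrite memn /is_polygon /= !inE !negb_or.
  by case/andP=> /and3P[/andP[uv' ->] -> ->] _ /and3P[wu wv ->]; rewrite uv' wv eq_sym wu.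
have Pi : is_polygon (insert_vertex u v w s) by rewrite -(is_polygon_rot m) Em.
have /andP[Ui _] := Pi; have /andP[Um _] := Pm; have /andP[Un _] := Pn.
split=> // [x|x y].
  rewrite -(mem_rot m) Em memn /= !inE.
  by do ![case: (_ == _) => //=]; rewrite ?orbT ?orbF.
rewrite -(polygon_edge_rot m) // Em -(@polygon_edge_rot _ n s) // En.
have := uniq_darts Pn; rewrite -!mem_darts // /darts /=.
set a := arcs _ _; rewrite !cat_uniq /= !mem_cat !inE !negb_or !mem_swap.
case/andP=> /and3P[uva _ _] /and3P[_ /andP[vua _] _].
have np : (x, y) \in [:: (u, v); (v, u)] -> ((x, y) \in a) || ((y, x) \in a) = false.
  by rewrite !inE => /orP[] /eqP[-> ->]; rewrite (negbTE uva) (negbTE vua).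
move: np; rewrite !(inE, mem_cat, mem_swap) /swap /= !xpair_eqE.
by do ![case: (_ == _) => //=]; do ![case: (_ \in _) => //=]; move=> // /(_ isT).
Qed.


Definition complex_darts X := flatten [seq darts s | s <- X].

Lemma mem_complex_darts X x y : all (@is_polygon T) X ->
  ((x, y) \in complex_darts X) = complex_edge X x y.
Proof.
elim: X => [|s X IH] //= /andP[/andP[Us _] /IH E].
by rewrite /complex_darts /= mem_cat mem_darts // -E.
Qed.

(* Equality of the Euler characteristics, stated without subtraction and doubled *)
(* since every edge gives two darts.                                              *)
Definition same_euler X Y :=
  2 * size (undup (flatten X)) + 2 * size X + size (undup (complex_darts Y)) =
  2 * size (undup (flatten Y)) + 2 * size Y + size (undup (complex_darts X)).

Lemma size_undup_mem (S : eqType) (s t : seq S) :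
  s =i t -> size (undup s) = size (undup t).
Proof. by move=> st; apply/perm_size/perm_undup. Qed.

Lemma same_euler_mem X Y : all (@is_polygon T) X -> all (@is_polygon T) Y ->
  flatten X =i flatten Y -> size X = size Y -> complex_edge X =2 complex_edge Y ->
  same_euler X Y.
Proof.
move=> PX PY EV ES EE; rewrite /same_euler (size_undup_mem EV) ES.
congr (_ + _); apply: size_undup_mem => -[x y].
by rewrite !mem_complex_darts // EE.
Qed.

(** One vertex and one edge are gained; the number of polygons is unchanged. *)
Lemma same_euler_subdivide u v w X : all (@is_polygon T) X -> complex_edge X u v ->
  w \notin flatten X ->
  let Y := [seq insert_vertex u v w s | s <- X] in
  all (@is_polygon T) Y /\ same_euler X Y.
Proof.
move=> PX uv wX Y.
have ins s : s \in X -> _ := fun sX => polygon_edge_insert u v (allP PX s sX)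
  (contra (fun ws => introT flattenP (ex_intro2 _ _ s sX ws)) wX).
have PY : all (@is_polygon T) Y.
  by apply/allP => _ /mapP[s /ins[Ps _ _] ->].
have uv_neq : u != v.
  by case/hasP: uv => s sX; apply: polygon_edge_neq; apply: (allP PX).
have [uX vX] : u \in flatten X /\ v \in flatten X.
  case/hasP: uv => s sX /polygon_edge_mem/andP[us vs].
  by split; apply/flattenP; exists s.
have uw : u != w by apply: contraNneq wX => <-.
have vw : v != w by apply: contraNneq wX => <-.
split=> //; rewrite /same_euler size_map.
have memV : flatten Y =i w :: flatten X.
  move=> x; rewrite inE; apply/flattenP/orP => [[_ /mapP[s sX ->]]|].
    have [_ -> _] := ins s sX; case/orP=> [xs|/andP[_ ->]]; last by left.
    by right; apply/flattenP; exists s.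
  case=> [/eqP ->|/flattenP[s sX xs]].
    case/hasP: uv => s sX suv; exists (insert_vertex u v w s); first exact: map_f.
    by have [_ -> _] := ins s sX; rewrite suv eqxx orbT.
  exists (insert_vertex u v w s); first exact: map_f.
  by have [_ -> _] := ins s sX; rewrite xs.
have edgeY x y : complex_edge Y x y =
    complex_edge X x y && ((x, y) \notin [:: (u, v); (v, u)]) ||
    ((x, y) \in [:: (u, w); (w, u); (w, v); (v, w)]).
  apply/hasP/orP => [[_ /mapP[s sX ->]]|].
    have [_ _ ->] := ins s sX; case/orP=> /andP[xy ->]; last by right.
    by left; rewrite andbT; apply/hasP; exists s.
  case=> [/andP[/hasP[s sX xy] n]|n].
    exists (insert_vertex u v w s); first exact: map_f.
    by have [_ _ ->] := ins s sX; rewrite xy n.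
  case/hasP: uv => s sX suv; exists (insert_vertex u v w s); first exact: map_f.
  by have [_ _ ->] := ins s sX; rewrite suv n orbT.
have edge_mem x y : complex_edge X x y -> x \in flatten X /\ y \in flatten X.
  by case/hasP=> s sX /polygon_edge_mem/andP[xs ys]; split; apply/flattenP; exists s.
have vu : complex_edge X v u.
  by apply/hasP; case/hasP: uv => s sX; exists s => //; rewrite polygon_edge_sym.
rewrite (size_undup_mem memV) /= (negbTE wX) /=.
(* The two darts of [uv] are traded for the four darts of [uw] and [wv]. *)
suff /perm_size : perm_eq ((u, v) :: (v, u) :: undup (complex_darts Y))
    ([:: (u, w); (w, u); (w, v); (v, w)] ++ undup (complex_darts X)).
  by clear => /=; lia.
apply: uniq_perm.
- rewrite /= !inE !mem_undup !mem_complex_darts // undup_uniq andbT !edgeY.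
  by rewrite !inE !xpair_eqE !eqxx (negbTE uv_neq) (negbTE uw) (negbTE vw) !andbF.
- rewrite /= !inE !mem_undup !mem_complex_darts // undup_uniq andbT !xpair_eqE.
  have nw x : complex_edge X x w = false.
    by apply/negP => /edge_mem[_ h]; rewrite h in wX.
  have wn x : complex_edge X w x = false.
    by apply/negP => /edge_mem[h _]; rewrite h in wX.
  rewrite !nw !wn [w == u]eq_sym [w == v]eq_sym (negbTE uw) (negbTE vw) (negbTE uv_neq).
  by rewrite !andbF.
move=> [x y]; rewrite mem_cat !inE !mem_undup !mem_complex_darts // edgeY !inE.
have [[-> ->]|_] := eqVneq (x, y) (u, v); first by rewrite uv !orbT.
have [[-> ->]|_] := eqVneq (x, y) (v, u); first by rewrite vu !orbT.
by rewrite /= andbT orbC !orbA.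
Qed.

(** One polygon and one edge are gained. The diagonal is a new edge because it is neither an edge of
    [X] nor, both sides being nonempty, of the polygon that is cut. *)
Lemma same_euler_cut u v s1 s2 X :
  all (@is_polygon T) ((u :: s1 ++ v :: s2) :: X) ->
  s1 != [::] -> s2 != [::] -> ~~ complex_edge X u v ->
  let Y := (u :: rcons s1 v) :: (v :: rcons s2 u) :: X in
  all (@is_polygon T) Y /\ same_euler ((u :: s1 ++ v :: s2) :: X) Y.
Proof.
move=> /= /andP[Ps PX] h1 h2 nuv.
have /andP[P1 P2] := is_polygon_cut h1 h2 Ps; rewrite P1 P2 PX; split=> //.
set Z := (X in same_euler X); set Y := (Y in same_euler _ Y); rewrite /same_euler.
have /size_undup_mem -> : flatten Y =i flatten Z.
  move=> x; rewrite /= !(inE, mem_cat, mem_rcons).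
  by do ![case: (_ == _) => //=]; do ![case: (_ \in _) => //=].
have -> : size Y = (size Z).+1 by [].
have PZ : all (@is_polygon T) Z by rewrite /= Ps.
have PY : all (@is_polygon T) Y by rewrite /= P1 P2.
have nuvZ : ~~ complex_edge Z u v.
  by rewrite /= negb_or nuv polygon_edge_diagonal.
have nvuZ : ~~ complex_edge Z v u.
  apply: contra nuvZ => /hasP[s sZ E]; apply/hasP; exists s => //.
  by rewrite polygon_edge_sym.
have uv_neq : u != v.
  by move: Ps => /andP[/= /andP[+ _] _]; rewrite mem_cat inE !negb_or => /and3P[].
suff /perm_size : perm_eq (undup (complex_darts Y))
    ((u, v) :: (v, u) :: undup (complex_darts Z)).
  by clear => /=; lia.
apply: uniq_perm; first exact: undup_uniq.
  rewrite !cons_uniq !inE !mem_undup !mem_complex_darts // undup_uniq nvuZ negb_or nuvZ.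
  by rewrite xpair_eqE (negbTE uv_neq).
move=> [x y]; rewrite !inE !mem_undup !mem_complex_darts // /= !orbA.
by rewrite polygon_edge_cut // !inE.
Qed.

(** Being made of polygons is carried along as an equality, not an implication, so that the
    induction passes through [pl_sym] and [pl_trans]. *)
Lemma pl_homeo_euler X Y : pl_homeo X Y ->
  all (@is_polygon T) X = all (@is_polygon T) Y /\
  (all (@is_polygon T) X -> same_euler X Y).
Proof.
elim=> {X Y} [X|X Y _ [<- h]|X Y Z _ [-> h1] _ [<- h2]|X Y XY|n s X|s X||].
- by [].
- by split=> // /h; rewrite /same_euler => ->.
- by split=> // PY; move: (h1 PY) (h2 PY); rewrite /same_euler; lia.
- have E := perm_all (@is_polygon T) XY; split=> // PX.
  apply: same_euler_mem; rewrite -?E //; last by move=> x y; apply: perm_has.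
    move=> x; apply/flattenP/flattenP => -[s sX xs]; exists s => //.
      by rewrite -(perm_mem XY).
    by rewrite (perm_mem XY).
  exact: perm_size.
- rewrite /= is_polygon_rot; split=> // /andP[Ps PX].
  have /andP[Us _] := Ps; apply: same_euler_mem => //.
  + by rewrite /= Ps.
  + by rewrite [all _ _]/= is_polygon_rot Ps.
  + by move=> x; rewrite -[flatten (rot n s :: X)]/(rot n s ++ flatten X)
      mem_cat mem_rot -mem_cat.
  + by move=> x y /=; rewrite polygon_edge_rot.
- rewrite /= is_polygon_rev; split=> // /andP[Ps PX].
  have /andP[Us _] := Ps; apply: same_euler_mem => //.
  + by rewrite /= Ps.
  + by rewrite [all _ _]/= is_polygon_rev Ps.
  + by move=> x; rewrite -[flatten (rev s :: X)]/(rev s ++ flatten X)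
      mem_cat mem_rev -mem_cat.
  + by move=> x y /=; rewrite polygon_edge_rev.
- move=> u v w X PX uv wX.
  by have [PY h] := same_euler_subdivide PX uv wX; rewrite PX PY.
- move=> u v s1 s2 X PX h1 h2 uv.
  by have [PY h] := same_euler_cut PX h1 h2 uv; rewrite PX PY.
Qed.

Lemma disk_euler X : all (@is_polygon T) X -> is_disk X ->
  2 * size (undup (flatten X)) + 2 * size X = size (undup (complex_darts X)) + 2.
Proof.
move=> PX [s Ps /pl_homeo_euler[_ /(_ PX)]]; rewrite /same_euler /complex_darts /= !cats0.
have /andP[Us _] := Ps.
by rewrite (undup_id Us) (undup_id (uniq_darts Ps)) size_darts; clear; lia.
Qed.

End EulerCharacteristic.

(** * Trees *)

Section Trees.
Variables (T : finType) (e : rel T).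
Hypothesis e_sym : symmetric e.

Lemma connect_crossing (B : {set T}) x y : connect e x y -> x \in B -> y \notin B ->
  exists a b, [/\ e a b, a \in B & b \notin B].
Proof.
case/connectP=> p; elim: p x => [|z p IH] x /=; first by move=> _ -> ->.
case/andP=> xz zp lst xB yB; have [zB|zB] := boolP (z \in B); first exact: IH zB yB.
by exists x, z.
Qed.

(** Otherwise a shortened path from [a] to [b], still avoiding [x], closes to a cycle through
    [x]. *)
Lemma acyclic_unique_branch x a b p : (forall c, ~ is_cycle e c) -> e x a -> e x b ->
  path e a p -> last a p = b -> x \notin a :: p -> a = b.
Proof.
move=> acyc xa xb ap lst xp; apply/eqP/negPn/negP => ab.
case/shortenP: ap lst => q aq Uq qp lst.
apply: (acyc (x :: a :: q)); split.
- rewrite cons_uniq Uq andbT; apply: contra xp; rewrite !inE => /orP[->//|/qp ->].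
  by rewrite orbT.
- by case: q lst {aq Uq qp} => //= ba; rewrite ba eqxx in ab.
- by rewrite /= xa rcons_path aq lst e_sym.
Qed.

Variable A : {set T}.
Hypothesis e_in : forall x y, e x y -> (x \in A) && (y \in A).

(** A subset grown from one vertex across edges that leave it gains two darts with every new
    vertex. *)
Lemma connected_card_darts : (forall x y, x \in A -> y \in A -> connect e x y) ->
  2 * (#|A| - 1) <= #|[set a : T * T | e a.1 a.2]|.
Proof.
move=> conn; have [->|[r rA]] := set_0Vmem A; first by rewrite cards0.
suff grow n : n < #|A| -> exists B : {set T}, [/\ B \subset A, #|B| = n.+1 &
    2 * n <= #|[set a : T * T | [&& e a.1 a.2, a.1 \in B & a.2 \in B]]|].
  have Apos : 0 < #|A| by apply/card_gt0P; exists r.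
  case: (grow (#|A| - 1)); first by lia.
  move=> B [_ _ h]; apply: leq_trans h _; apply: subset_leq_card.
  by apply/subsetP => a; rewrite !inE => /andP[].
elim: n => [|n IH] nA; first by exists [set r]; rewrite sub1set rA cards1.
have [B [BA cB dB]] := IH (ltnW nA).
have [y yA yB] : exists2 y, y \in A & y \notin B.
  by apply/subsetPn; apply: contraTN nA => /subset_leq_card; rewrite cB -leqNgt.
have [x xB] : exists x, x \in B by apply/card_gt0P; rewrite cB.
have [a [b [ab aB bB]]] := connect_crossing (conn _ _ (subsetP BA _ xB) yA) xB yB.
have /andP[_ bA] := e_in ab.
exists (b |: B); split; first by rewrite subUset sub1set bA.
  by rewrite cardsU1 bB cB.
set D := [set _ | _] in dB.
have abD : (a, b) \notin (b, a) |: D.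
  by rewrite !inE /= !xpair_eqE (negbTE bB) !andbF orbF; apply: contraNN bB => /andP[/eqP <-].
have baD : (b, a) \notin D by rewrite inE /= (negbTE bB) andbF.
apply: (@leq_trans #|(a, b) |: ((b, a) |: D)|).
  by rewrite cardsU1 abD cardsU1 baD; lia.
apply/subset_leq_card/subsetP => -[u v]; rewrite !inE /=.
case/or3P=> [/eqP[-> ->]|/eqP[-> ->]|/and3P[-> -> ->]]; last by rewrite !orbT.
- by rewrite ab aB eqxx !orbT.
- by rewrite e_sym ab aB eqxx !orbT.
Qed.

End Trees.

(** Deleting an edge of a cycle would keep the graph connected with too few darts for
    [connected_card_darts]. *)
Lemma connected_acyclic (T : finType) (e : rel T) (A : {set T}) :
  symmetric e -> (forall x y, e x y -> (x \in A) && (y \in A)) ->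
  (forall x y, x \in A -> y \in A -> connect e x y) ->
  #|[set a : T * T | e a.1 a.2]| <= 2 * (#|A| - 1) -> forall c, ~ is_cycle e c.
Proof.
move=> e_sym e_in conn few [|x [|a p]] [Uc sc] //= cyc.
pose e' := [rel y z | e y z && ((y, z) \notin [:: (x, a); (a, x)])].
have e'_sym : symmetric e'.
  move=> y z; rewrite /= e_sym !inE; congr (_ && ~~ _).
  by rewrite !xpair_eqE; do ![case: (_ == _) => //=].
have xa : e x a by case/andP: cyc.
have e'ax : connect e' a x.
  apply/connectP; exists (rcons p x); last by rewrite last_rcons.
  have /arcs_rcons_chord/andP[n1 n2] : is_polygon (a :: rcons p x).
    by rewrite -rcons_cons -rot1_cons is_polygon_rot; apply/andP.
  case/andP: cyc => _; rewrite !path_arcs => /allP h; apply/allP => -[y z] yz /=.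
  rewrite (h _ yz) !inE; apply/norP; split.
    by apply: contra n2 => /eqP <-.
  by apply: contra n1 => /eqP <-.
have e'xa : connect e' x a by rewrite (sym_connect_sym e'_sym).
have conn' y z : y \in A -> z \in A -> connect e' y z.
  move=> yA zA; apply: connect_sub (conn y z yA zA) => u v uv.
  have [|n] := boolP ((u, v) \in [:: (x, a); (a, x)]).
    by rewrite !inE => /orP[] /eqP[-> ->].
  by apply: connect1; rewrite /= uv n.
have := connected_card_darts e'_sym (fun y z h => e_in y z (proj1 (andP h))) conn'.
apply/negP; rewrite -ltnNge; apply: leq_trans few.
apply/proper_card/properP; split; first by apply/subsetP => -[y z]; rewrite !inE => /andP[].
by exists (x, a); rewrite inE /= ?xa // !inE eqxx.
Qed.

(** * Facets and edges of a polyhedral map *)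

Lemma polygon_edge_map (T S : eqType) (h : T -> S) (s : seq T) x y :
  injective h -> uniq s ->
  polygon_edge (map h s) (h x) (h y) = polygon_edge s x y.
Proof.
by move=> inj_h Us; rewrite /polygon_edge !mem_map // !next_map // !inj_eq.
Qed.

Lemma is_polygon_map (T S : eqType) (h : T -> S) (s : seq T) :
  injective h -> is_polygon (map h s) = is_polygon s.
Proof. by move=> inj_h; rewrite /is_polygon map_inj_uniq // size_map. Qed.

Lemma card_polygon_edge (T : finType) (s : seq T) : is_polygon s ->
  #|[set a : T * T | polygon_edge s a.1 a.2]| = 2 * size s.
Proof.
move=> Ps; have /andP[Us _] := Ps.
rewrite -size_darts -(card_uniqP (uniq_darts Ps)).
by apply: eq_card => -[x y]; rewrite inE mem_darts.
Qed.

Section PolyhedralMap.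
Variables (V F : finType) (K : F -> seq V).
Hypothesis hK : polyhedral_map K.
Implicit Types (f g h : F) (A : {set F}) (x y u v w : V).

Let facet_polygon f : is_polygon (K f) := surface_polygon (proj1 hK) f.

Lemma facet_uniq f : uniq (K f).
Proof. by case/andP: (facet_polygon f). Qed.

Definition edge_count A x y := #|[set f in A | polygon_edge (K f) x y]|.

Lemma facets_on_edge f x y : polygon_edge (K f) x y ->
  #|[set g | polygon_edge (K g) x y]| = 2.
Proof. by move=> fxy; apply: (surface_edge (proj1 hK)); apply/existsP; exists f. Qed.

Lemma edge_third_facet f g h x y : f != g ->
  polygon_edge (K f) x y -> polygon_edge (K g) x y -> polygon_edge (K h) x y ->
  (h == f) || (h == g).
Proof.
move=> fg fxy gxy hxy; have /eqP E : [set f; g] == [set g | polygon_edge (K g) x y].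
  rewrite eqEcard (facets_on_edge fxy) cards2 fg andbT.
  by apply/subsetP => k; rewrite !inE => /orP[] /eqP ->.
have: h \in [set g | polygon_edge (K g) x y] by rewrite inE.
by rewrite -E !inE.
Qed.

Lemma edge_other_facet f x y : polygon_edge (K f) x y ->
  exists2 g, f != g & polygon_edge (K g) x y.
Proof.
move=> fxy; have := facets_on_edge fxy; rewrite (cardsD1 f) inE fxy add1n => -[c1].
have /card_gt0P[g] : 0 < #|[set g | polygon_edge (K g) x y] :\ f| by rewrite c1.
by rewrite !inE eq_sym => /andP[fg gxy]; exists g.
Qed.

Lemma common_edge_vertex f g x y v : f != g ->
  polygon_edge (K f) x y -> polygon_edge (K g) x y ->
  v \in K f -> v \in K g -> (v == x) || (v == y).
Proof.
move=> fg fxy gxy vf vg.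
have mem z : z \in K f -> z \in K g -> z \in common_vertices K f g.
  by move=> zf zg; rewrite inE zf.
have xy := polygon_edge_neq (facet_polygon f) fxy.
have /andP[/mem xf /mem yf] := polygon_edge_mem fxy.
have /andP[/xf xC /yf yC] := polygon_edge_mem gxy; have vC := mem v vf vg.
case: (hK.2 f g fg) => [E|[z E]|[z [t [E _ _]]]]; move: xC yC vC xy; rewrite E !inE //.
- by move=> /eqP -> /eqP ->; rewrite eqxx.
- by case/orP=> /eqP ->; case/orP=> /eqP -> //; rewrite ?eqxx // orbC.
Qed.

Lemma card_common_darts f g : f != g ->
  #|[set a : V * V | polygon_edge (K f) a.1 a.2 && polygon_edge (K g) a.1 a.2]|
  = 2 * share_edge K f g.
Proof.
move=> fg; case: (boolP (share_edge K f g)) => [|nsh]; last first.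
  apply/eqP; rewrite cards_eq0; apply/eqP/setP => -[x y]; rewrite !inE.
  by apply: contraNF nsh => h; apply/existsP; exists x; apply/existsP; exists y.
case/existsP=> x /existsP[y /andP[fxy gxy]].
have xy := polygon_edge_neq (facet_polygon f) fxy.
rewrite muln1 -[RHS](_ : #|[set (x, y); (y, x)]| = 2); last first.
  by rewrite cards2 xpair_eqE (negbTE xy).
apply: eq_card => -[u v]; rewrite !inE /= !xpair_eqE; apply/andP/idP => [[fuv guv]|].
  have uv := polygon_edge_neq (facet_polygon f) fuv.
  have /andP[uf vf] := polygon_edge_mem fuv; have /andP[ug vg] := polygon_edge_mem guv.
  move: uv; have := common_edge_vertex fg fxy gxy uf ug.
  case/orP: (common_edge_vertex fg fxy gxy vf vg) => /eqP ->; case/orP=> /eqP ->;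
    by rewrite ?eqxx ?orbT.
case/orP=> /andP[/eqP -> /eqP ->] //; by split; rewrite polygon_edge_sym.
Qed.

(** Double counting of pairs of a neighbour [g] and a dart common to [f] and [g]: by
    [card_common_darts] each neighbour accounts for two darts. *)
Lemma card_adjacent_facets A f :
  2 * #|[set g in A | (f != g) && share_edge K f g]| =
  \sum_(a : V * V | polygon_edge (K f) a.1 a.2)
    #|[set g in A | (f != g) && polygon_edge (K g) a.1 a.2]|.
Proof.
rewrite -sum1dep_card big_distrr /=.
under [RHS]eq_bigr do rewrite -sum1dep_card.
rewrite [RHS](exchange_big_dep (fun g => (g \in A) && (f != g))) /=; last first.
  by move=> a g _ /and3P[-> ->].
rewrite (eq_bigl (fun g => ((g \in A) && (f != g)) && share_edge K f g)); last first.
  by move=> g; rewrite andbA.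
rewrite big_mkcondr /=; apply: eq_bigr => g /andP[gA fg].
rewrite sum1dep_card gA fg /= -[if _ then _ else _]/(if share_edge K f g then 2 * 1 else 0).
by rewrite card_common_darts //; case: share_edge.
Qed.

Lemma card_neighbours f : #|[set g | (f != g) && share_edge K f g]| = size (K f).
Proof.
apply/eqP; rewrite -(eqn_pmul2l (isT : 0 < 2)) -card_polygon_edge //; apply/eqP.
have E : [set g in setT | (f != g) && share_edge K f g] =
    [set g | (f != g) && share_edge K f g] by apply/setP => g; rewrite !inE.
rewrite -E card_adjacent_facets.
rewrite -sum1dep_card; apply: eq_bigr => -[x y] /= fxy.
have := facets_on_edge fxy; rewrite (cardsD1 f) inE fxy add1n => -[c1]; rewrite -c1.
by apply: eq_card => g; rewrite !inE eq_sym.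
Qed.

Lemma edge_count_le2 A x y : edge_count A x y <= 2.
Proof.
rewrite leqNgt; apply/negP => gt2.
have /card_gt0P[f] : 0 < edge_count A x y by apply: leq_trans gt2.
rewrite inE => /andP[fA fxy]; move: gt2; apply/negP; rewrite -leqNgt.
rewrite -(facets_on_edge fxy); apply: subset_leq_card.
by apply/subsetP => g; rewrite !inE => /andP[].
Qed.

Lemma edge_count_gt0 A f x y : f \in A -> polygon_edge (K f) x y -> 0 < edge_count A x y.
Proof. by move=> fA fxy; apply/card_gt0P; exists f; rewrite inE fA. Qed.

Lemma edge_count_facet A x y : 0 < edge_count A x y ->
  exists2 f, f \in A & polygon_edge (K f) x y.
Proof. by case/card_gt0P=> f; rewrite inE => /andP[]; exists f. Qed.

Lemma sum_facet_edges A (w : V * V -> nat) :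
  \sum_(f in A) \sum_(a | polygon_edge (K f) a.1 a.2) w a =
  \sum_(a : V * V) edge_count A a.1 a.2 * w a.
Proof.
rewrite (exchange_big_dep predT) //=; apply: eq_bigr => a _.
by rewrite sum_nat_cond_const.
Qed.

Lemma sum_facet_sizes A :
  2 * \sum_(f in A) size (K f) =
  #|[set a : V * V | edge_count A a.1 a.2 == 1]| +
  2 * #|[set a : V * V | edge_count A a.1 a.2 == 2]|.
Proof.
rewrite big_distrr /= -!sum1dep_card big_distrr /= [X in _ = X + _]big_mkcond.
rewrite [X in _ = _ + X]big_mkcond -big_split /=.
under eq_bigr => f _ do rewrite -card_polygon_edge // -sum1dep_card.
rewrite sum_facet_edges; apply: eq_bigr => a _.
by have := edge_count_le2 A a.1 a.2; case: edge_count => [|[|[|]]].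
Qed.

(** Two adjacent facets share one edge, hence two darts, and each dart inside [A] lies on two
    ordered pairs of facets; the two factors cancel. *)
Lemma sum_adjacent_facets A :
  #|[set a : F * F | [&& a.1 \in A, a.2 \in A & (a.1 != a.2) && share_edge K a.1 a.2]]|
  = #|[set a : V * V | edge_count A a.1 a.2 == 2]|.
Proof.
apply/eqP; rewrite -(eqn_pmul2l (isT : 0 < 2)); apply/eqP.
rewrite -sum1dep_card -(pair_big_dep (mem A)
  (fun f g => (g \in A) && ((f != g) && share_edge K f g)) (fun _ _ => 1)) /=.
rewrite big_distrr /=.
under eq_bigr => f fA.
  rewrite sum1dep_card card_adjacent_facets.
  under eq_bigr => a fa.
    (* For a dart of [f] in [A], the number of other facets of [A] on it is one or zero, according
       as the edge is inner or not. *)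
    rewrite (_ : #|_| = (edge_count A a.1 a.2 == 2)); last first.
      have -> : edge_count A a.1 a.2 =
          1 + #|[set g in A | (f != g) && polygon_edge (K g) a.1 a.2]|.
        rewrite /edge_count (cardsD1 f) inE fA fa; congr (_ + _).
        by apply: eq_card => g; rewrite !inE eq_sym andbCA.
      have: 1 + #|[set g in A | (f != g) && polygon_edge (K g) a.1 a.2]| <= 2.
        have := edge_count_le2 A a.1 a.2.
        rewrite /edge_count (cardsD1 f) inE fA fa; congr (_ + _ <= _).
        by apply: eq_card => g; rewrite !inE eq_sym andbCA.
      by case: #|_| => [|[|]].
    over.
  over.
rewrite sum_facet_edges -sum1dep_card big_distrr /= [RHS]big_mkcond.
by apply: eq_bigr => a _ /=; case: eqP => [->|]; rewrite ?muln1 ?muln0.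
Qed.

End PolyhedralMap.

(** * From a Hamiltonian disk to a proper tree *)

Section ArcCrossing.
Variables (T : eqType) (B : pred T).

Lemma arcs_exit x s z : B x -> z \in s -> ~~ B z ->
  exists a b, [/\ (a, b) \in arcs x s, B a & ~~ B b].
Proof.
elim: s x => //= y s IH x Bx; rewrite inE => zs nBz.
have [By|nBy] := boolP (B y); last by exists x, y; rewrite mem_head.
case/orP: zs => [/eqP zy|zs]; first by rewrite zy By in nBz.
by have [a [b [ab Ba Bb]]] := IH y By zs nBz; exists a, b; rewrite inE ab orbT.
Qed.

Lemma arcs_entry x s z : z \in x :: s -> ~~ B z -> B (last x s) ->
  exists a b, [/\ (a, b) \in arcs x s, ~~ B a & B b].
Proof.
elim: s x z => [|y s IH] x z /=; first by rewrite inE => /eqP -> /negbTE ->.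
rewrite inE => zs nBz Bl; have [By|nBy] := boolP (B y); last first.
  have [a [b [ab Ba Bb]]] := IH y y (mem_head _ _) nBy Bl.
  by exists a, b; rewrite inE ab orbT.
case/orP: zs => [/eqP zx|zs]; first by exists x, y; rewrite mem_head By -zx.
by have [a [b [ab Ba Bb]]] := IH y z zs nBz Bl; exists a, b; rewrite inE ab orbT.
Qed.

End ArcCrossing.

Section DiskToTree.
Variables (V F : finType) (K : F -> seq V) (M : V -> seq F).
Hypothesis hK : polyhedral_map K.
Hypothesis hM : dual_map K M.
Implicit Types (f g h : F) (A : {set F}) (x y u v w : V).

Let facet_polygon f : is_polygon (K f) := surface_polygon (proj1 hK) f.

Lemma mem_dual v f : (f \in M v) = (v \in K f).
Proof. exact: (proj2 (hM.2 v)). Qed.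

Lemma dual_edgeE f g : edge_graph M f g = (f != g) && share_edge K f g.
Proof. exact: hM.1. Qed.

Lemma dual_deg f : deg (edge_graph M) f = size (K f).
Proof.
rewrite -(card_neighbours hK); apply: eq_card => g; by rewrite !inE dual_edgeE.
Qed.

Lemma share_edge_sym f g : share_edge K f g = share_edge K g f.
Proof.
by apply: eq_existsb => x; apply: eq_existsb => y; rewrite andbC.
Qed.

Lemma dual_edge_at v f g : v \in K f -> v \in K g -> edge_graph M f g ->
  f != g /\ exists w, polygon_edge (K f) v w && polygon_edge (K g) v w.
Proof.
rewrite dual_edgeE => vf vg /andP[fg /existsP[x /existsP[y /andP[fxy gxy]]]]; split=> //.
case/orP: (common_edge_vertex hK fg fxy gxy vf vg) => /eqP ->.
  by exists y; rewrite fxy.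
by exists x; rewrite polygon_edge_sym fxy polygon_edge_sym.
Qed.

Lemma facet_complex_polygons A : all (@is_polygon nat) (facet_complex K A).
Proof.
apply/allP => _ /mapP[f _ ->]; have /andP[Uf sf] := facet_polygon f.
by rewrite /is_polygon (map_inj_uniq (pcan_inj pickleK)) Uf size_map.
Qed.

(** The doubled Euler relation, transported from the labels in [nat] back to [V]; since [A] covers
    all vertices, the vertex count is [|V|]. *)
Lemma disk_count A : (forall x, exists2 f, f \in A & x \in K f) ->
  is_disk (facet_complex K A) ->
  2 * #|V| + 2 * #|A| = #|[set a : V * V | 0 < edge_count K A a.1 a.2]| + 2.
Proof.
move=> cov /(disk_euler (facet_complex_polygons A)).
have inj := pcan_inj (@pickleK V).
have -> : size (facet_complex K A) = #|A| by rewrite size_map cardE.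
have -> : size (undup (flatten (facet_complex K A))) = #|V|.
  rewrite cardE -[RHS](size_map pickle); apply/perm_size/uniq_perm.
  - exact: undup_uniq.
  - by rewrite (map_inj_uniq inj) enum_uniq.
  move=> n; rewrite mem_undup; apply/flattenP/mapP => [[_ /mapP[f _ ->] /mapP[x _ ->]]|].
    by exists x; rewrite // mem_enum.
  case=> x _ ->; have [f fA xf] := cov x.
  exists (map pickle (K f)); last exact: map_f.
  by apply/mapP; exists f; rewrite ?mem_enum.
suff -> : size (undup (complex_darts (facet_complex K A))) =
    #|[set a : V * V | 0 < edge_count K A a.1 a.2]| by [].
rewrite cardE -[RHS](size_map (fun a : V * V => (pickle a.1, pickle a.2))).
apply/perm_size/uniq_perm; first exact: undup_uniq.
  by rewrite map_inj_uniq ?enum_uniq // => -[x y] [u v] [/inj -> /inj ->].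
move=> [m n]; rewrite mem_undup mem_complex_darts ?facet_complex_polygons //.
apply/hasP/mapP => [[_ /mapP[f fA ->] fmn]|[[x y]]].
  have /andP[/mapP[x _ Ex] /mapP[y _ Ey]] := polygon_edge_mem fmn.
  move: fmn; rewrite Ex Ey polygon_edge_map ?(facet_uniq hK) // => fxy.
  rewrite mem_enum in fA; exists (x, y); rewrite // mem_enum inE.
  exact: edge_count_gt0 fA fxy.
rewrite mem_enum inE => /edge_count_facet[f fA fxy] [-> ->].
exists (map pickle (K f)); first by apply/mapP; exists f; rewrite ?mem_enum.
by rewrite polygon_edge_map // (facet_uniq hK).
Qed.

Variables (A : {set F}) (c : seq V).
Hypothesis c_polygon : is_polygon c.
Hypothesis c_full : forall x, x \in c.
Hypothesis c_boundary : forall u v, polygon_edge c u v = (edge_count K A u v == 1).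
Hypothesis M_polygon : forall v, is_polygon (M v).

Let c_uniq : uniq c. Proof. by case/andP: c_polygon. Qed.

Lemma boundary_facets v w : polygon_edge c v w ->
  exists f g, [/\ f \in A, g \notin A, polygon_edge (K f) v w & polygon_edge (K g) v w].
Proof.
rewrite c_boundary => /cards1P[f Ef]; have := set11 f; rewrite -Ef inE => /andP[fA fvw].
have [g fg gvw] := edge_other_facet hK fvw.
exists f, g; split=> //; apply: contra fg => gA.
have : g \in [set f] by rewrite -Ef inE gA.
by rewrite inE eq_sym.
Qed.

Lemma disk_covers x : exists2 f, f \in A & x \in K f.
Proof.
have : polygon_edge c x (next c x) by rewrite polygon_edge_neighbours // eqxx.
by case/boundary_facets=> f [_ [fA _ /polygon_edge_mem/andP[xf _] _]]; exists f.
Qed.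

Lemma disk_counts : is_disk (facet_complex K A) ->
  #|[set a : V * V | edge_count K A a.1 a.2 == 2]| = 2 * (#|A| - 1) /\
  \sum_(f in A) size (K f) = #|V| + 2 * (#|A| - 1).
Proof.
move=> /(disk_count disk_covers).
have sz : size c = #|V|.
  by rewrite -(card_uniqP c_uniq); apply: eq_card => x; rewrite c_full.
have N1 : #|[set a : V * V | edge_count K A a.1 a.2 == 1]| = 2 * #|V|.
  rewrite -sz -card_polygon_edge //.
  by apply: eq_card => a; rewrite !inE c_boundary.
have -> : #|[set a : V * V | 0 < edge_count K A a.1 a.2]| =
    #|[set a : V * V | edge_count K A a.1 a.2 == 1]| +
    #|[set a : V * V | edge_count K A a.1 a.2 == 2]|.
  rewrite -cardsUI; set I := _ :&: _; have -> : I = set0.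
    by apply/setP => a; rewrite !inE; case: eqP => // ->.
  rewrite cards0 addn0; apply: eq_card => a; rewrite !inE.
  by have := edge_count_le2 hK A a.1 a.2; case: edge_count => [|[|[|]]].
have := sum_facet_sizes hK A; rewrite N1.
have [x _] := card_gt0P (surface_nonempty (proj1 hK)).
have [f fA _] := disk_covers x; have : 0 < #|A| by apply/card_gt0P; exists f.
clear; set N2 := #|[set a | _ == 2]|; set S := \sum_(_ in _) _; lia.
Qed.

Lemma boundary_crossing v f g : f \in A -> g \notin A -> v \in K f -> v \in K g ->
  edge_graph M f g ->
  exists w, [/\ polygon_edge (K f) v w, polygon_edge (K g) v w & polygon_edge c v w].
Proof.
move=> fA gA vf vg /(dual_edge_at vf vg)[fg [w /andP[fvw gvw]]].
exists w; split=> //; rewrite c_boundary; apply/cards1P; exists f.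
apply/setP => h; rewrite !inE; apply/andP/eqP => [[hA hvw]|-> //].
case/orP: (edge_third_facet hK fg fvw gvw hvw) => /eqP E //.
by rewrite E (negbTE gA) in hA.
Qed.

Lemma crossing_unique v w f g f' g' : f \in A -> g \notin A -> f' \in A -> g' \notin A ->
  polygon_edge (K f) v w -> polygon_edge (K g) v w ->
  polygon_edge (K f') v w -> polygon_edge (K g') v w -> f = f' /\ g = g'.
Proof.
move=> fA gA fA' gA' fvw gvw fvw' gvw'.
have fg : f != g by apply: contraNneq gA => <-.
split.
  case/orP: (edge_third_facet hK fg fvw gvw fvw') => /eqP E //.
  by rewrite -E fA' in gA.
case/orP: (edge_third_facet hK fg fvw gvw gvw') => /eqP E //.
by rewrite E fA in gA'.
Qed.

(** The proper tree will be the whole dual graph induced on the facets of the disk. *)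
Definition induced_edge f g := [&& f \in A, g \in A & edge_graph M f g].

Lemma induced_edge_sym : symmetric induced_edge.
Proof.
by move=> f g; rewrite /induced_edge !dual_edgeE andbCA eq_sym share_edge_sym.
Qed.

(* Around [v] the boundary of the disk is crossed exactly on the two edges of *)
(* [c] at [v], so the facets of the disk are consecutive on [M v].            *)
Lemma disk_facets_consecutive v f g p1 p2 i : rot i (M v) = f :: p1 ++ g :: p2 ->
  f \in A -> g \in A -> all (mem A) p1 || all (mem A) p2.
Proof.
move=> Er fA gA; apply/norP => -[/allPn[z1 z1p nz1] /allPn[z2 z2p nz2]].
have /andP[UM _] := M_polygon v; have Ur := UM; rewrite -(rot_uniq i) Er in Ur.
have Ea : cyclic_arcs (rot i (M v)) = arcs f (rcons p1 g) ++ arcs g (rcons p2 f).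
  by rewrite Er /= rcons_cat arcs_cat.
have memM a b : (a, b) \in arcs f (rcons p1 g) ++ arcs g (rcons p2 f) ->
    (a, b) \in cyclic_arcs (M v).
  by rewrite -Ea !mem_cyclic_arcs ?rot_uniq // mem_rot next_rot.
have edgeM a b : (a, b) \in cyclic_arcs (M v) ->
    [/\ v \in K a, v \in K b, edge_graph M a b & edge_graph M b a].
  move=> ab; have h : polygon_edge (M v) a b by rewrite polygon_edgeE // ab.
  rewrite -!mem_dual; have /andP[-> ->] := polygon_edge_mem h.
  split=> //; apply/existsP; exists v => //; by rewrite polygon_edge_sym.
have [a1 [b1 [ab1 aA1 bA1]]] : exists a b,
    [/\ (a, b) \in arcs f (rcons p1 g), a \in A & b \notin A].
  by apply: (@arcs_exit _ (mem A) f _ z1); rewrite // mem_rcons inE z1p orbT.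
have [a2 [b2 [ab2 aA2 bA2]]] : exists a b,
    [/\ (a, b) \in arcs g (rcons p2 f), a \in A & b \notin A].
  by apply: (@arcs_exit _ (mem A) g _ z2); rewrite // mem_rcons inE z2p orbT.
(* A third crossing, back into [A], on the same arc from [f] to [g] as the first. *)
have [b3 [a3 [ba3 bA3 aA3]]] : exists b a,
    [/\ (b, a) \in arcs f (rcons p1 g), b \notin A & a \in A].
  apply: (@arcs_entry _ (mem A) f _ z1); rewrite // ?last_rcons //.
  by rewrite inE mem_rcons inE z1p !orbT.
have a12 : a1 != a2.
  have /(map_f fst) := ab1; have /(map_f fst) := ab2.
  rewrite -![map _ _]/(unzip1 _) !unzip1_arcs !belast_rcons /= => a2p a1p.
  move: Ur; rewrite -cat_cons cat_uniq => /and3P[_ /hasPn h _].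
  by apply: contraTneq a1p => ->; apply: h.
have {}ab1 : (a1, b1) \in cyclic_arcs (M v) by apply: memM; rewrite mem_cat ab1.
have {}ab2 : (a2, b2) \in cyclic_arcs (M v) by apply: memM; rewrite mem_cat ab2 orbT.
have {}ba3 : (b3, a3) \in cyclic_arcs (M v) by apply: memM; rewrite mem_cat ba3.
have [va1 vb1 e1 _] := edgeM _ _ ab1; have [va2 vb2 e2 _] := edgeM _ _ ab2.
have [vb3 va3 _ e3] := edgeM _ _ ba3.
have [w1 [aw1 bw1 cw1]] := boundary_crossing aA1 bA1 va1 vb1 e1.
have [w2 [aw2 bw2 cw2]] := boundary_crossing aA2 bA2 va2 vb2 e2.
have [w3 [aw3 bw3 cw3]] := boundary_crossing aA3 bA3 va3 vb3 e3.
have w12 : w1 != w2.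
  apply: contraNneq a12 => E; rewrite -E in aw2 bw2.
  by have [-> _] := crossing_unique aA1 bA1 aA2 bA2 aw1 bw1 aw2 bw2.
(* Only two edges of [c] leave [v], and [w1], [w2] use up both. The third crossing thus repeats one
   of the others, giving an arc of [M v] in both directions. *)
have /orP[/eqP E|/eqP E] : (w3 == w1) || (w3 == w2).
  move: cw1 cw2 cw3 w12; rewrite !polygon_edge_neighbours //.
  by do 3!case/orP=> /eqP ->; rewrite ?eqxx ?orbT.
- rewrite E in aw3 bw3.
  have [Ea3 Eb3] := crossing_unique aA1 bA1 aA3 bA3 aw1 bw1 aw3 bw3.
  by have := cyclic_arcs_asym (M_polygon v) ab1; rewrite Ea3 Eb3 ba3.
- rewrite E in aw3 bw3.
  have [Ea3 Eb3] := crossing_unique aA2 bA2 aA3 bA3 aw2 bw2 aw3 bw3.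
  by have := cyclic_arcs_asym (M_polygon v) ab2; rewrite Ea3 Eb3 ba3.
Qed.

Lemma induced_arc_path v f p g : uniq (f :: rcons p g) ->
  (forall a b, (a, b) \in arcs f (rcons p g) -> polygon_edge (M v) a b) ->
  f \in A -> g \in A -> all (mem A) p ->
  tree_path_on induced_edge (M v) f (rcons p g).
Proof.
move=> U edge fA gA pA; rewrite /tree_path_on U path_arcs /=; apply/allP => -[a b] ab /=.
have mv := edge a b ab; rewrite mv andbT /induced_edge.
have memA h : h \in f :: rcons p g -> h \in A.
  rewrite inE mem_rcons inE => /or3P[/eqP ->|/eqP ->|] //; exact: (allP pA).
rewrite !memA ?andTb.
- by apply/existsP; exists v.
- by have := map_f snd ab; rewrite -[map _ _]/(unzip2 _) unzip2_arcs inE orbC => ->.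
- have := map_f fst ab; rewrite -[map _ _]/(unzip1 _) unzip1_arcs belast_rcons /= !inE.
  by rewrite mem_rcons inE; case: (a == f) => //= ->; rewrite orbT.
Qed.

Lemma induced_face_path v f g : f \in A -> g \in A -> f \in M v -> g \in M v ->
  exists2 s, tree_path_on induced_edge (M v) f s & last f s = g.
Proof.
move=> fA gA fv gv; have [->|fg] := eqVneq f g; first by exists [::].
have /andP[UM _] := M_polygon v.
have [i p1 p2 _ _ Er] := rot_to_arc UM fv gv fg.
have Ur := UM; rewrite -(rot_uniq i) Er in Ur.
have edgeM a b : (a, b) \in arcs f (rcons p1 g) ++ arcs g (rcons p2 f) ->
    polygon_edge (M v) a b.
  move=> ab; rewrite polygon_edgeE // mem_cyclic_arcs // -(next_rot i) // -(mem_rot i).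
  by rewrite -mem_cyclic_arcs ?rot_uniq // Er /= rcons_cat arcs_cat ab.
have [U1 U2] : uniq (f :: rcons p1 g) /\ uniq (g :: rcons p2 f).
  move: Ur; rewrite /= !rcons_uniq !mem_rcons !inE !mem_cat !inE cat_uniq /= !negb_or.
  case/andP=> /and3P[-> ne ->] /and4P[-> /andP[-> _] -> ->].
  by rewrite ne eq_sym ne.
case/orP: (disk_facets_consecutive Er fA gA) => pA.
  exists (rcons p1 g); last by rewrite last_rcons.
  by apply: induced_arc_path => // a b ab; apply: edgeM; rewrite mem_cat ab.
(* The second arc runs from [g] to [f], so it is traversed backwards. *)
exists (rev (g :: p2)); last by rewrite rev_cons last_rcons.
have /andP[_ pth] : tree_path_on induced_edge (M v) g (rcons p2 f).
  by apply: induced_arc_path => // a b ab; apply: edgeM; rewrite mem_cat ab orbT.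
apply/andP; split.
  by rewrite -rev_rcons rev_uniq; move: U2.
have := rev_path (fun a b => induced_edge a b && polygon_edge (M v) a b) g (rcons p2 f).
rewrite last_rcons belast_rcons => ->; apply: sub_path pth => a b.
by rewrite induced_edge_sym polygon_edge_sym.
Qed.

(** An edge of [c] at [v] has a facet outside [A] on its other side. The path misses this facet, so
    it has at most [size (M v) - 1] vertices. *)
Lemma induced_face_length v f s : f \in A -> f \in M v ->
  tree_path_on induced_edge (M v) f s -> size s <= size (M v) - 2.
Proof.
move=> fA fv /andP[U pth]; have /andP[UM sM] := M_polygon v.
have [_ [g [_ gA _ gv]]] : exists f g, [/\ f \in A, g \notin A, v \in K f & v \in K g].
  have : polygon_edge c v (next c v) by rewrite polygon_edge_neighbours // eqxx.
  case/boundary_facets=> a [b [aA bA /polygon_edge_mem/andP[va _] ]].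
  by case/polygon_edge_mem/andP=> vb _; exists a, b.
have sub : {subset f :: s <= [seq h <- M v | h != g]}.
  move=> h hs; rewrite mem_filter.
  suff /andP[hA ->] : (h \in A) && (h \in M v).
    by rewrite andbT; apply: contraNneq gA => <-.
  move: hs; rewrite inE => /orP[/eqP -> |hs]; first by rewrite fA.
  move: pth; rewrite path_arcs => /allP h2.
  have [a ah] : exists a, (a, h) \in arcs f s.
    move: hs; rewrite -{1}(unzip2_arcs f s) => /mapP[[a b] ab ->]; by exists a.
  by case/andP: (h2 _ ah) => /and3P[_ -> _] /polygon_edge_mem/andP[_ ->].
have := uniq_leq_size U sub.
have : size [seq h <- M v | h != g] < size (M v).
  rewrite size_filter -[X in _ < X](count_predC (fun h => h != g)) -addn1 leq_add2l.
  by rewrite -has_count; apply/hasP; exists g; rewrite ?mem_dual //= negbK.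
by rewrite /=; move: (size _) (size s) (size _); clear => a b d; lia.
Qed.

(** Facets of [A] at one vertex are joined by [induced_face_path]; each edge of [c] lies on a facet
    of [A], which links its two ends, and [c] reaches every vertex. *)
Lemma induced_tree_connected f g : f \in A -> g \in A -> connect induced_edge f g.
Proof.
have at_vertex v a b : a \in A -> b \in A -> v \in K a -> v \in K b ->
    connect induced_edge a b.
  move=> aA bA; rewrite -!mem_dual => av bv.
  have [s /andP[_ pth] <-] := induced_face_path aA bA av bv.
  apply/connectP; exists s => //; apply: sub_path pth => y z /andP[]//.
have conn x y : connect (polygon_edge c) x y -> forall a b, a \in A -> b \in A ->
    x \in K a -> y \in K b -> connect induced_edge a b.
  case/connectP=> p; elim: p x => [|z p IH] x /=; first by move=> _ -> a b; apply: at_vertex.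
  case/andP=> xz zp lst a b aA bA xa yb.
  have [h [_ [hA _ /polygon_edge_mem/andP[xh zh] _]]] := boundary_facets xz.
  exact: connect_trans (at_vertex x a h aA hA xa xh) (IH z zp lst h b hA bA zh yb).
move=> fA gA.
have vertex h : exists x, x \in K h.
  by have /andP[_] := facet_polygon h; case: (K h) => // x s _; exists x; rewrite mem_head.
have [x xf] := vertex f; have [y yg] := vertex g.
apply: (conn x y) => //.
have fc : fconnect (next c) x y.
  rewrite (@fconnect_cycle _ _ c) ?c_full //; exact: cycle_next.
apply: connect_sub fc => a b /eqP <-; apply: connect1.
by rewrite polygon_edge_neighbours // eqxx.
Qed.

Lemma induced_proper_tree : is_disk (facet_complex K A) -> proper_tree M A induced_edge.
Proof.
move=> /disk_counts[N2 sizes].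
have [x _] := card_gt0P (surface_nonempty (proj1 hK)); have [f fA _] := disk_covers x.
split.
- split.
  + exact: induced_edge_sym.
  + by move=> a b.
  + by apply/set0Pn; exists f.
  + exact: induced_tree_connected.
  + apply: (connected_acyclic (A := A)).
    * exact: induced_edge_sym.
    * by move=> a b /and3P[-> ->].
    * exact: induced_tree_connected.
    * rewrite -N2 -(sum_adjacent_facets hK); apply: eq_leq; apply: eq_card => -[a b].
      by rewrite !inE /= /induced_edge dual_edgeE.
- by rewrite -sizes; apply: eq_bigr => g _; rewrite dual_deg.
- exact: induced_face_path.
- exact: induced_face_length.
Qed.

End DiskToTree.

(** * From a proper tree to a Hamiltonian disk *)

Lemma pl_homeo_rot_rev (T : eqType) (b : bool) n (s : seq T) X :
  pl_homeo (s :: X) (rot n (if b then rev s else s) :: X).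
Proof.
apply: pl_trans (pl_rot n _ X); case: b; [exact: pl_rev | exact: pl_refl].
Qed.

(** The cut along a diagonal, read backwards. *)
Lemma pl_homeo_glue (T : eqType) (u v : T) (s1 s2 : seq T) X :
  is_polygon (u :: s1 ++ v :: s2) -> all (@is_polygon T) X -> s1 != [::] -> s2 != [::] ->
  ~~ complex_edge X u v ->
  pl_homeo ((u :: rcons s1 v) :: (v :: rcons s2 u) :: X) ((u :: s1 ++ v :: s2) :: X).
Proof.
by move=> Ps PX h1 h2 nuv; apply: pl_sym; apply: pl_cut_polygon => //=; rewrite Ps.
Qed.

Section TreeToDisk.
Variables (V F : finType) (K : F -> seq V) (M : V -> seq F).
Hypothesis hK : polyhedral_map K.
Hypothesis hM : dual_map K M.
Variables (VT : {set F}) (ET : rel F).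
Hypothesis hT : proper_tree M VT ET.
Implicit Types (f g h : F) (B C : {set F}) (x y u v w : V).

Let facet_polygon f : is_polygon (K f) := surface_polygon (proj1 hK) f.

Let tree := proper_tree_in hT.

Definition restricted_edge B := [rel f g | [&& ET f g, f \in B & g \in B]].

Lemma restricted_edge_sym B : symmetric (restricted_edge B).
Proof. by move=> f g; rewrite /= (tree_sym tree) [(f \in B) && _]andbC. Qed.

(* The tree path from [f] to a facet of [B] through [w] enters [B] by the only *)
(* edge joining [f] to the subtree [B].                                        *)
Lemma attachment_vertex B r f a h w : r \in B ->
  (forall b, b \in B -> connect (restricted_edge B) r b) ->
  B \subset VT -> f \in VT -> f \notin B -> a \in B -> ET a f ->
  h \in B -> w \in K f -> w \in K h -> w \in K a.
Proof.
move=> rB conn BVT fT fB aB af hB wf wh.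
have memM g : (g \in M w) = (w \in K g) := mem_dual hM w g.
have [||s /andP[]] := @proper_face_path _ _ _ _ _ hT w f h fT (subsetP BVT _ hB).
- by rewrite memM.
- by rewrite memM.
case: s => [|g s] /=; first by move=> _ _ fh; rewrite -fh (negbTE fB) in hB.
case/andP=> fgs _ /andP[/andP[fg /polygon_edge_mem/andP[_ gw]]].
move/(sub_path (e' := ET) (fun g1 g2 e12 => proj1 (andP e12))) => pth lst.
suff <- : g = a by rewrite -memM.
(* Continuing inside [B] from [h] to [a] cannot return to [f], so [acyclic_unique_branch] identifies
   the first step [g] with [a]. *)
have : connect (restricted_edge B) h a.
  by apply: connect_trans (conn a aB); rewrite (sym_connect_sym (@restricted_edge_sym B)) conn.
case/connectP=> q hq qa; apply: (acyclic_unique_branch (tree_sym tree) (x := f) (p := s ++ q)).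
- exact: (tree_acyclic tree).
- by [].
- by rewrite (tree_sym tree).
- rewrite cat_path pth lst; apply: sub_path hq => y z /andP[] //.
- by rewrite last_cat lst -qa.
rewrite -cat_cons mem_cat negb_or fgs /=; apply: contra fB => fq.
have [b bf] : exists b, (b, f) \in arcs h q.
  by move: fq; rewrite -{1}(unzip2_arcs h q) => /mapP[[b b'] bb ->]; exists b.
by move: hq; rewrite path_arcs => /allP/(_ _ bf)/and3P[].
Qed.

Lemma facet_complexD1 C f : f \in C ->
  perm_eq (facet_complex K C) (map pickle (K f) :: facet_complex K (C :\ f)).
Proof.
move=> fC; rewrite -[_ :: _]/(map (fun f => map pickle (K f)) (f :: enum (C :\ f))).
apply: perm_map; apply: uniq_perm; first exact: enum_uniq.
  by rewrite /= enum_uniq mem_enum !inE eqxx.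
by move=> g; rewrite inE !mem_enum !inE; case: eqVneq => // ->.
Qed.

Lemma edge_countU1 B f x y : f \notin B ->
  edge_count K (f |: B) x y = polygon_edge (K f) x y + edge_count K B x y.
Proof.
move=> fB; rewrite /edge_count (cardsD1 f) !inE eqxx; congr (_ + _).
apply: eq_card => g; rewrite !inE; case: eqVneq => // ->.
by rewrite (negbTE fB).
Qed.

(* The facets outside [B] are carried along because [pl_homeo] is not stable under *)
(* adding facets to both sides.                                                    *)
Definition merges_to B (P : seq V) :=
  [/\ is_polygon P,
      forall x, x \in P -> exists2 f, f \in B & x \in K f,
      forall x y, polygon_edge P x y = (edge_count K B x y == 1),
      size P + 2 * (#|B| - 1) = \sum_(f in B) size (K f)
    & pl_homeo (facet_complex K VT) (map pickle P :: facet_complex K (VT :\: B))].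

Lemma merges_to1 r : r \in VT -> merges_to [set r] (K r).
Proof.
move=> rT; split=> //.
- by move=> x xr; exists r; rewrite ?inE.
- move=> x y; have -> : [set r] = r |: set0 by rewrite setU0.
  rewrite edge_countU1 ?inE // /edge_count.
  have -> : [set f in set0 | polygon_edge (K f) x y] = set0.
    by apply/setP => f; rewrite !inE.
  by rewrite cards0; case: polygon_edge.
- by rewrite cards1 big_set1 addn0.
- exact/pl_perm/facet_complexD1.
Qed.

(** The new facet meets those of [B] only in the ends of the edge [uv] shared with [a], so gluing
    along [uv] gives a simple polygon, with [size P + size (K f) - 2] sides. *)
Lemma merges_toU1 B P r f a : merges_to B P -> r \in B ->
  (forall b, b \in B -> connect (restricted_edge B) r b) ->
  B \subset VT -> f \in VT -> f \notin B -> a \in B -> ET a f ->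
  exists Q, merges_to (f |: B) Q.
Proof.
move=> [PP memP edgeP sizeP plP] rB conn BVT fT fB aB af.
have af_neq : a != f by apply: contraNneq fB => <-.
have [u [v [auv fuv]]] : exists u v, polygon_edge (K a) u v /\ polygon_edge (K f) u v.
  have /and3P[_ _] := tree_edge tree af; rewrite (dual_edgeE hM) => /andP[_].
  by case/existsP=> u /existsP[v /andP[auv fuv]]; exists u, v.
have uv := polygon_edge_neq (facet_polygon f) fuv.
have common h w : h \in B -> w \in K h -> w \in K f -> (w == u) || (w == v).
  move=> hB wh wf.
  have wa := attachment_vertex rB conn BVT fT fB aB af hB wf wh.
  exact (common_edge_vertex hK af_neq auv fuv wa wf).
have on_uv h : polygon_edge (K h) u v -> (h == a) || (h == f).
  by move=> huv; exact (edge_third_facet hK af_neq auv fuv huv).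
(* The two facets on [uv] are [a] in [B] and [f] outside [B], so [uv] is an edge of the polygon
   [P]. *)
have countuv : edge_count K B u v = 1.
  apply/eqP/cards1P; exists a; apply/setP => h; rewrite !inE.
  apply/andP/eqP => [[hB /on_uv/orP[]/eqP //]|->//].
  by move=> E; rewrite -E hB in fB.
have Puv : polygon_edge P u v by rewrite edgeP countuv.
have [b1 [n1 [s1 E1]]] := polygon_edge_last PP Puv.
have fvu : polygon_edge (K f) v u by rewrite polygon_edge_sym.
have [b2 [n2 [s2 E2]]] := polygon_edge_last (facet_polygon f) fvu.
have P1 : is_polygon (u :: rcons s1 v).
  by rewrite -E1 is_polygon_rot; case: (b1); rewrite ?is_polygon_rev.
have P2 : is_polygon (v :: rcons s2 u).
  by rewrite -E2 is_polygon_rot; case: (b2); rewrite ?is_polygon_rev.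
have mem1 x : (x \in P) = (x \in u :: rcons s1 v).
  by rewrite -E1 mem_rot; case: (b1); rewrite ?mem_rev.
have mem2 x : (x \in K f) = (x \in v :: rcons s2 u).
  by rewrite -E2 mem_rot; case: (b2); rewrite ?mem_rev.
have size1 : size P = (size s1).+2.
  have := congr1 size E1; rewrite size_rot /= size_rcons => <-.
  by case: (b1); rewrite ?size_rev.
have size2 : size (K f) = (size s2).+2.
  have := congr1 size E2; rewrite size_rot /= size_rcons => <-.
  by case: (b2); rewrite ?size_rev.
have h1 : s1 != [::] by move: P1 => /andP[_]; case: (s1).
have h2 : s2 != [::] by move: P2 => /andP[_]; case: (s2).
have /andP[U1 _] := P1; have /andP[U2 _] := P2.
have PQ : is_polygon (u :: s1 ++ v :: s2).
  apply/andP; split; last first.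
    by move: h1; rewrite -size_eq0 /= size_cat /=; case: (size s1) => // k _; rewrite addnS.
  move: U1 U2; rewrite /= !rcons_uniq !mem_rcons !inE !mem_cat !inE cat_uniq /= !negb_or.
  case/andP=> /andP[-> us1] /andP[vs1 ->] /andP[/andP[_ vs2] /andP[us2 ->]].
  rewrite us1 us2 vs1 vs2 /= andbT; apply/hasPn => x xs2; apply/negP => xs1.
  (* A repeated vertex would be common to [f] and a facet of [B], hence [u] or [v]; but the inner
     parts [s1] and [s2] avoid both. *)
  have /orP[/eqP E|/eqP E] : (x == u) || (x == v).
    have /memP[h hB xh] : x \in P by rewrite mem1 inE mem_rcons inE xs1 !orbT.
    by apply: common hB xh _; rewrite mem2 inE mem_rcons inE xs2 !orbT.
  - by rewrite -E xs2 in us2.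
  - by rewrite -E xs2 in vs2.
have edge1 x y : polygon_edge (u :: rcons s1 v) x y = polygon_edge P x y.
  have /andP[UP _] := PP; rewrite -E1 polygon_edge_rot; last by case: (b1); rewrite ?rev_uniq.
  by case: (b1); rewrite ?polygon_edge_rev.
have edge2 x y : polygon_edge (v :: rcons s2 u) x y = polygon_edge (K f) x y.
  have Uf := facet_uniq hK f.
  rewrite -E2 polygon_edge_rot; last by case: (b2); rewrite ?rev_uniq.
  by case: (b2); rewrite ?polygon_edge_rev.
exists (u :: s1 ++ v :: s2); split=> //.
- move=> x; have -> : (x \in u :: s1 ++ v :: s2) = (x \in P) || (x \in K f).
    rewrite mem1 mem2 !(inE, mem_cat, mem_rcons).
    by do ![case: (_ == _) => //=]; do ![case: (_ \in _) => //=].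
  case/orP=> [/memP[h hB xh]|xf]; first by exists h; rewrite // !inE hB orbT.
  by exists f; rewrite // !inE eqxx.
(* The edge [uv] now lies on two facets and leaves the boundary. No other edge of [f] lies on a
   facet of [B], since both its ends would be among [u] and [v]. *)
- move=> x y; rewrite edge_countU1 //; have := polygon_edge_cut x y h1 h2 PQ.
  have := polygon_edge_diagonal h1 h2 PQ; set Q := u :: _ ++ _; rewrite edge1 edge2.
  have [|nuv] := boolP ((x, y) \in _).
    rewrite !inE => /orP[] /eqP[-> ->] /negbTE nQ _; first by rewrite nQ fuv countuv.
    have -> : edge_count K B v u = 1 by apply/eqP; rewrite -edgeP polygon_edge_sym.
    by rewrite polygon_edge_sym nQ fvu.
  move=> _ /= <-; rewrite edgeP; case fxy: (polygon_edge (K f) x y); last by rewrite orbF.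
  rewrite orbT; apply/esym; rewrite -[X in _ == X]addn0 eqn_add2l -leqn0 leqNgt.
  apply/negP => /edge_count_facet[h hB hxy].
  have xy := polygon_edge_neq (facet_polygon f) fxy.
  have /andP[xf yf] := polygon_edge_mem fxy; have /andP[xh yh] := polygon_edge_mem hxy.
  move: nuv xy; rewrite !inE !xpair_eqE.
  case/orP: (common h x hB xh xf) => /eqP ->; case/orP: (common h y hB yh yf) => /eqP ->;
    by rewrite ?eqxx ?orbT.
- rewrite big_setU1 //= -sizeP cardsU1 fB size2 size1 size_cat /=.
  have : 0 < #|B| by apply/card_gt0P; exists r.
  by move: (size s1) (size s2) #|B|; clear => n m k; lia.
have -> : VT :\: (f |: B) = (VT :\: B) :\ f.
  by apply/setP => g; rewrite !inE negb_or andbA.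
have fD : f \in VT :\: B by rewrite !inE fB.
set X := facet_complex K (_ :\ f).
have injp := pcan_inj (@pickleK V).
have swapX (s t : seq nat) Z : pl_homeo (s :: t :: Z) (t :: s :: Z).
  by apply: pl_perm; rewrite -[s :: _]/([:: s] ++ [:: t] ++ Z) perm_catCA.
apply: pl_trans plP _.
apply: (pl_trans (Y := map pickle P :: map pickle (K f) :: X)).
  by apply: pl_perm; rewrite perm_cons; apply: facet_complexD1.
apply: pl_trans (pl_homeo_rot_rev b1 n1 _ _) _.
apply: pl_trans (swapX _ _ _) _; apply: pl_trans (pl_homeo_rot_rev b2 n2 _ _) _.
apply: pl_trans (swapX _ _ _) _.
have mapE b n (s : seq V) : rot n (if b then rev (map pickle s) else map pickle s) =
    map pickle (rot n (if b then rev s else s)).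
  by rewrite map_rot; case: b; rewrite // map_rev.
rewrite !mapE E1 E2 /= map_cat !map_rcons /=; apply: pl_homeo_glue.
- by have := PQ; rewrite -(is_polygon_map _ injp) /= map_cat.
- exact: facet_complex_polygons.
- by rewrite -size_eq0 size_map size_eq0.
- by rewrite -size_eq0 size_map size_eq0.
(* Only [a] and [f] contain [uv], and neither is among the facets still to be merged, so the gluing
   is a legitimate reversed cut. *)
apply/hasPn => _ /mapP[h hX ->]; move: hX; rewrite mem_enum !inE => /and3P[hf hB _].
rewrite polygon_edge_map ?(facet_uniq hK) //; apply/negP => /on_uv/orP[]/eqP E.
  by rewrite E aB in hB.
by rewrite E eqxx in hf.
Qed.

Lemma tree_merges : exists P, merges_to VT P.
Proof.
have /set0Pn[r rT] := tree_nonempty tree.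
suff grow n : n < #|VT| -> exists B, [/\ B \subset VT, #|B| = n.+1, r \in B,
    forall b, b \in B -> connect (restricted_edge B) r b & exists P, merges_to B P].
  have Tpos : 0 < #|VT| by apply/card_gt0P; exists r.
  case: (grow #|VT|.-1); first by rewrite prednK.
  move=> B [BT cB _ _ [P hP]]; exists P.
  suff <- : B = VT by [].
  by apply/eqP; rewrite eqEcard BT cB prednK /=.
elim: n => [|n IH] nT.
  exists [set r]; rewrite sub1set cards1 set11; split=> //.
    by move=> b; rewrite inE => /eqP ->; apply: connect0.
  by exists (K r); apply: merges_to1.
have [B [BT cB rB conn [P hP]]] := IH (ltnW nT).
have [y yT yB] : exists2 y, y \in VT & y \notin B.
  by apply/subsetPn; apply: contraTN nT => /subset_leq_card; rewrite cB -leqNgt.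
have [a [f [af aB fB]]] := connect_crossing (tree_connected tree rT yT) rB yB.
have /and3P[_ fT _] := tree_edge tree af.
exists (f |: B); split.
- by rewrite subUset sub1set fT.
- by rewrite cardsU1 fB cB.
- by rewrite !inE rB orbT.
- have mono b : connect (restricted_edge B) r b -> connect (restricted_edge (f |: B)) r b.
    apply: connect_sub => g h /and3P[gh gB hB]; apply: connect1.
    by rewrite /= gh !inE gB hB !orbT.
  move=> b; rewrite !inE => /orP[/eqP ->|/conn/mono //].
  apply: connect_trans (mono a (conn a aB)) (connect1 _).
  by rewrite /= af !inE aB eqxx orbT.
- exact: merges_toU1 hP rB conn BT fT fB aB af.
Qed.

Lemma tree_hamiltonian_disk :
  exists c, hamiltonian_cycle (edge_graph K) c /\ contractible K c.
Proof.
have [P [PP _ edgeP sizeP plP]] := tree_merges; have /andP[UP sP] := PP.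
exists P; split; last first.
  exists VT; split; last exact: edgeP.
  exists (map pickle P); first by rewrite (is_polygon_map _ (pcan_inj pickleK)).
  move: plP; rewrite setDv; suff -> : facet_complex K set0 = [::] by [].
  by rewrite /facet_complex enum_set0.
split; last first.
  (* Degrees in [M] are facet sizes, so the degree condition and the size recorded by [merges_to]
     cancel to this. *)
  have size_full : #|P| = #|V|.
    rewrite (card_uniqP UP); move: (proper_degree hT).
    have -> : \sum_(f in VT) deg (edge_graph M) f = \sum_(f in VT) size (K f).
      by apply: eq_bigr => f _; rewrite (dual_deg hK hM).
    by rewrite -sizeP => /eqP; rewrite eqn_add2r => /eqP.
  by move=> x; rewrite (subset_cardP size_full (subset_predT _)).
split=> //; rewrite cycle_arcs; apply/allP => -[x y] xy /=.
have : polygon_edge P x y by rewrite polygon_edgeE // xy.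
rewrite edgeP => /eqP c1.
have [|f _ fxy] := @edge_count_facet _ _ K VT x y; first by rewrite c1.
by apply/existsP; exists f.
Qed.

End TreeToDisk.

Theorem theorem1 (V F : finType) (K : F -> seq V) (M : V -> seq F)
    (hK : polyhedral_map K) (hE : equivelar K) (hM : dual_map K M) :
  (exists c : seq V, hamiltonian_cycle (edge_graph K) c /\ contractible K c) <->
  (exists (VT : {set F}) (ET : rel F), proper_tree M VT ET).
Proof.
split=> [[c [[[Uc sc _] c_full] [A [A_disk c_boundary]]]]|[VT [ET hT]]]; last first.
  exact (tree_hamiltonian_disk hK hM hT).
(* Equivelarity enters here: the facets at [v] number [q], which is at least 3. *)
have M_polygon v : is_polygon (M v).
  have [p [q [_ q3 _ degv]]] := hE; have [UM memM] := hM.2 v.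
  rewrite /is_polygon UM -(card_uniqP UM) (eq_card (B := [set f | v \in K f])) ?degv //.
  by move=> f; rewrite inE memM.
exists A, (induced_edge M A).
apply: (induced_proper_tree hK hM (c := c)) => //.
by rewrite /is_polygon Uc sc.
Qed.
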